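(* Let $f\in\mathcal{A}_c(\mathbb{T})$. The trigonometric polynomials are dense in $\mathcal{A}_c(\mathbb{T})$ (with respect to $\|\cdot\|_{\mathbb{T}}$): with $k_n$ the Fej\'er kernel and $\sigma_n[f]=k_n\ast f$, $$\sigma_n[f](t)=\frac1{2\pi}\sum_{k=-n}^n\left(1-\frac{|k|}{n+1}\right)\hat f(k)e^{ikt}\quad\text{and}\quad\lim_{n\to\infty}\|f-\sigma_n[f]\|_{\mathbb{T}}=0.$$ If $\hat f(n)=0$ for all $n\in\mathbb{Z}$ then $f=0$.
   Context: ''Periodic'' means $2\pi$-periodic, and $\mathbb{T}$ is modelled by $[-\pi,\pi)$. $\mathcal{B}_c(\mathbb{T})$ is the set of continuous $F:\mathbb{R}\to\mathbb{R}$ with $F(-\pi)=0$ and $F(y+2n\pi)=F(y)+nF(\pi)$ for all $y\in[-\pi,\pi)$, $n\in\mathbb{Z}$. $\mathcal{A}_c(\mathbb{T})$ is the set of Schwartz distributions $f$ on $\mathbb{R}$ such that $f=F'$ (distributional derivative) for some $F\in\mathcal{B}_c(\mathbb{T})$; this $F$ is unique and is called the primitive of $f$. The continuous primitive integral is $\int_a^bf=F(b)-F(a)$. Periodic locally Lebesgue integrable functions are identified with elements of $\mathcal{A}_c(\mathbb{T})$. The Alexiewicz norm is $\|f\|_{\mathbb{T}}=\sup_{|I|\le2\pi}\left|\int_If\right|$, supremum over intervals $I\subset\mathbb{R}$ of length at most $2\pi$. For $f\in\mathcal{A}_c(\mathbb{T})$ with primitive $F$ and $g$ periodic of bounded variation,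 $\int_{-\pi}^{\pi}fg=F(\pi)g(\pi)-\int_{-\pi}^{\pi}F\,dg$ (Riemann--Stieltjes integral; real and imaginary parts treated separately), and $g\ast f(x)=f\ast g(x)=\int_{-\pi}^{\pi}f(x-t)g(t)\,dt$, where $t\mapsto f(x-t)$ is the distribution $f\circ r_x\in\mathcal{A}_c(\mathbb{T})$, $r_x(t)=x-t$. Fourier coefficients: $\hat f(n)=\int_{-\pi}^{\pi}f(t)e^{-int}\,dt$. The Fej\'er kernel is $$k_n(t)=\frac1{2\pi}\sum_{k=-n}^n\left(1-\frac{|k|}{n+1}\right)e^{ikt}.$$ *)

(* Defs.v *)
(* Stdlib reals with Coquelicot. *)
From Stdlib Require Import Reals ZArith Lra ClassicalEpsilon.
From Coquelicot Require Import Coquelicot.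
Open Scope R_scope.

(** * Schwartz distributions on the real line *)

Record test_function : Type := TestFunction {
  tf :> R -> R;
  tf_smooth : forall (n : nat) (x : R), ex_derive_n tf n x;
  tf_support : exists M : R, forall x : R, M < Rabs x -> tf x = 0
}.

Definition tf_cvg (phi : nat -> test_function) (psi : test_function) : Prop :=
  (exists M : R, forall (j : nat) (x : R), M < Rabs x -> phi j x = 0) /\
  (forall (m : nat) (eps : posreal),
     eventually (fun j => forall x : R,
       Rabs (Derive_n (phi j) m x - Derive_n psi m x) < eps)).

(* Functionals take complex values, so that complex-valued functions are
   distributions as well; it is enough to test against real functions. *)
Definition functional : Type := test_function -> C.

Definition is_distribution (f : functional) : Prop :=
  (forall (a b : R) (phi psi chi : test_function),
     (forall x : R, chi x = a * phi x + b * psi x) ->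
     f chi = (RtoC a * f phi + RtoC b * f psi)%C) /\
  (forall (phi : nat -> test_function) (psi : test_function),
     tf_cvg phi psi ->
     filterlim (fun j => f (phi j)) eventually (locally (f psi))).

Definition sub_dist (f g : functional) : functional :=
  fun phi => (f phi - g phi)%C.

Definition int_line (h : R -> R) : R :=
  RInt_gen h (Rbar_locally m_infty) (Rbar_locally p_infty).

(* The distribution identified with a function [h].  Only continuous [h] are
   needed, so the Riemann integral is enough. *)
Definition dist_of (h : R -> C) : functional :=
  fun phi => (int_line (fun t => Re (h t) * phi t),
              int_line (fun t => Im (h t) * phi t)).

Definition dist_derive (F : R -> R) : functional :=
  fun phi => RtoC (- int_line (fun t => F t * Derive phi t)).

Lemma reflect_smooth (x : R) (phi : test_function) (n : nat) (t : R) :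
  ex_derive_n (fun t => phi (x - t)) n t.
Proof.
apply ex_derive_n_ext with (f := fun t => (fun y => phi (y + x)) (- t)).
- intros s; f_equal; ring.
- apply (ex_derive_n_comp_opp (fun y => phi (y + x))).
  apply filter_forall; intros y k _.
  apply (ex_derive_n_comp_trans phi), tf_smooth.
Qed.

Lemma reflect_support (x : R) (phi : test_function) :
  exists M : R, forall t : R, M < Rabs t -> phi (x - t) = 0.
Proof.
destruct (tf_support phi) as [M HM].
exists (M + Rabs x); intros t Ht; apply HM.
assert (H := Rabs_triang_inv t x).
rewrite Rabs_minus_sym; lra.
Qed.

Definition tf_reflect (x : R) (phi : test_function) : test_function :=
  TestFunction (fun t => phi (x - t))
    (reflect_smooth x phi) (reflect_support x phi).

(* The composition of [f] with [r_x : t |-> x - t].  It acts by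
   [phi |-> f (phi o r_x)] because [r_x] is its own inverse and its derivative
   has absolute value 1. *)
Definition dist_reflect (x : R) (f : functional) : functional :=
  fun phi => f (tf_reflect x phi).

(** * Continuous primitive integral on the circle *)

Definition Bc (F : R -> R) : Prop :=
  (forall x : R, continuous F x) /\
  F (- PI) = 0 /\
  (forall (y : R) (n : Z), - PI <= y < PI ->
     F (y + 2 * IZR n * PI) = F y + IZR n * F PI).

Definition is_primitive (f : functional) (F : R -> R) : Prop :=
  Bc F /\ (forall phi : test_function, f phi = dist_derive F phi).

Definition Ac (f : functional) : Prop :=
  is_distribution f /\ exists F : R -> R, is_primitive f F.

(* Meaningful for [Ac f] only; the primitive is then unique. *)
Definition primitive (f : functional) : R -> R :=
  epsilon (inhabits (fun _ : R => 0)) (is_primitive f).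

Definition cpint (f : functional) (a b : R) : R :=
  primitive f b - primitive f a.

(* Supremum in the extended reals; it is finite when [Ac f]. *)
Definition Alexiewicz (f : functional) : Rbar :=
  Lub_Rbar (fun v => exists a b : R,
    a <= b /\ b - a <= 2 * PI /\ v = Rabs (cpint f a b)).

(** * Integrals of products, convolution, Fourier series *)

(* Sums of F(xi_i) (g(x_(i+1)) - g(x_i)), modelled on [Riemann_sum]. *)
Definition RS_sum (F g : R -> R) (ptd : @SF_seq R) : R :=
  seq.foldr Rplus 0
    (seq.pairmap (fun x y : R * R => F (snd y) * (g (fst y) - g (fst x)))
       (SF_h ptd, 0) (SF_t ptd)).

Definition is_RSInt (F g : R -> R) (a b l : R) : Prop :=
  filterlim (RS_sum F g) (Riemann_fine a b) (locally l).

(* Intended for [a <= b]. *)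
Definition RSInt (F g : R -> R) (a b : R) : R := iota (is_RSInt F g a b).

Definition int_mul_re (f : functional) (g : R -> R) : R :=
  primitive f PI * g PI - RSInt (primitive f) g (- PI) PI.

Definition int_mul (f : functional) (g : R -> C) : C :=
  (int_mul_re f (fun t => Re (g t)), int_mul_re f (fun t => Im (g t))).

Definition conv (g : R -> C) (f : functional) : R -> C :=
  fun x => int_mul (dist_reflect x f) g.

(* e^(i x) *)
Definition cis (x : R) : C := (cos x, sin x).

(* The sum of [a k] over the integers [-n <= k <= n]. *)
Definition sum_sym (n : nat) (a : Z -> C) : C :=
  sum_n (fun j => a (Z.of_nat j - Z.of_nat n)%Z) (2 * n).

Definition fourier (f : functional) (n : Z) : C :=
  int_mul f (fun t => cis (- (IZR n * t))).

Definition fejer (n : nat) (t : R) : C :=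
  (RtoC (/ (2 * PI)) *
   sum_sym n (fun k =>
     RtoC (1 - IZR (Z.abs k) / (INR n + 1)) * cis (IZR k * t)))%C.

Definition fejer_mean (n : nat) (f : functional) : R -> C := conv (fejer n) f.

Definition trig_poly (p : R -> C) : Prop :=
  exists (n : nat) (c : Z -> C), forall t : R,
    p t = sum_sym n (fun k => c k * cis (IZR k * t))%C.

(* Since primitives are real, the members of [Ac] of the form [dist_of p] with
   [p] a trigonometric polynomial are those with [p] real-valued. *)
Definition Ac_dense (P : functional -> Prop) : Prop :=
  forall f : functional, Ac f -> forall eps : posreal,
    exists g : functional,
      P g /\ Ac g /\ Rbar_lt (Alexiewicz (sub_dist f g)) eps.

(* Main.v *)
Require Import Defs.
From Stdlib Require Import Reals ZArith Lra Lia.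
From Stdlib Require Import FunctionalExtensionality ClassicalEpsilon.
From Coquelicot Require Import Coquelicot.
Open Scope R_scope.

(** Everything is transferred from the distribution [f] to its primitive [F], a
    continuous function with [F (x + 2 PI) = F x + F PI].

    The primitive is well defined: a continuous function that annihilates all
    derivatives of test functions is constant ([du_Bois_Reymond], by means of
    bumps made from [exp (- 1 / x)]), so [F] is determined by [f]
    ([primitive_eq]).  In particular a primitive of [f o r_x], and one of
    [f - g], may simply be exhibited.

    For a continuously differentiable [g] the Stieltjes integral of [F] against
    [dg] is the Riemann integral of [F * g'], so pairing with [g] is linear in [g]
    and given by an explicit formula ([int_mul_re_C1]).  If [g] is also periodic,
    a change of variable and the quasi-periodicity of [F] show that the
    convolution at [x] is the pairing of [f] with [g (x - .)]
    ([int_mul_re_reflect]).  Applied to [cis (k (x - t))] and summed, this is the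
    formula for the Fejer means ([fejer_mean_fourier]).

    The Fejer mean is the derivative of [x |-> int F (x - s) k_n s ds]
    ([conv_primitive_derive]), so that after subtracting a constant this function
    is its primitive, and convergence in the Alexiewicz norm is implied by uniform
    convergence of [int F (x - s) k_n s ds] to [F x].  The latter is proved without
    splitting the integral: [F] is uniformly continuous and has bounded increments
    over a period, hence
      [Rabs (F x - F (x - s)) <= eps + K * (1 - cos s)] for [- PI <= s <= PI]
    with [K] independent of [x] ([Bc_increment]); the kernel is nonnegative with
    integral [1]; and its integral against [1 - cos s] is exactly [1 / (n + 1)],
    because [(1 - cos s) * k_n s] is a multiple of [1 - cos ((n + 1) s)]
    ([RInt_fejer_moment]).  The error is therefore at most [eps + K / (n + 1)]
    ([conv_fejer_close]).

    If all Fourier coefficients vanish, so do the Fejer means and their primitives,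
    and the uniform estimate forces [F = 0] ([fourier_zero]). *)

(** * Integrals of continuous functions *)

Lemma ex_RInt_cont (h : R -> R) (a b : R) :
  (forall x, continuous h x) -> ex_RInt h a b.
Proof. intros Hh; apply (ex_RInt_continuous h); intros; apply Hh. Qed.

Lemma RInt_split (h : R -> R) (a b c : R) :
  (forall x, continuous h x) -> RInt h a b + RInt h b c = RInt h a c.
Proof. intros Hh; apply (RInt_Chasles h a b c); now apply ex_RInt_cont. Qed.

Lemma RInt_eq (g h : R -> R) (a b : R) :
  (forall x, g x = h x) -> RInt g a b = RInt h a b.
Proof. intros E; apply (RInt_ext g h); intros; apply E. Qed.

Lemma RInt_lin (g h : R -> R) (c d a b : R) :
  (forall x, continuous g x) -> (forall x, continuous h x) ->
  RInt (fun t => c * g t + d * h t) a b = c * RInt g a b + d * RInt h a b.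
Proof.
intros Hg Hh; apply is_RInt_unique.
apply (is_RInt_plus (V := R_NormedModule) (fun t => c * g t) (fun t => d * h t));
  apply (is_RInt_scal (V := R_NormedModule));
  now apply (RInt_correct (V := R_CompleteNormedModule)), ex_RInt_cont.
Qed.

Lemma RInt_scale (g : R -> R) (c a b : R) :
  (forall x, continuous g x) ->
  RInt (fun t => c * g t) a b = c * RInt g a b.
Proof.
intros Hg; apply (RInt_scal (V := R_CompleteNormedModule)).
now apply ex_RInt_cont.
Qed.

Lemma RInt_null (h : R -> R) (a b : R) :
  (forall x, Rmin a b < x < Rmax a b -> h x = 0) -> RInt h a b = 0.
Proof.
intros H0; rewrite (RInt_ext h (fun _ => 0)) by exact H0.
rewrite RInt_const; apply (Rmult_0_r (b - a)).
Qed.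

(** A continuous function vanishing outside [[a, b]] has a constant integral
    over every larger interval, hence the improper integral converges to it. *)
Lemma int_line_compact (h : R -> R) (a b : R) :
  a <= b -> (forall x, continuous h x) ->
  (forall x, x < a \/ b < x -> h x = 0) ->
  int_line h = RInt h a b.
Proof.
intros Hab Hc H0; apply (is_RInt_gen_unique h); intros P HP.
exists (fun x => x < a) (fun x => b < x); [now exists a | now exists b |].
intros x y Hx Hy; exists (RInt h a b); split; [|now apply locally_singleton].
assert (E : RInt h x y = RInt h a b).
{ rewrite <- (RInt_split h x a y Hc), <- (RInt_split h a b y Hc).
  rewrite (RInt_null h x a), (RInt_null h b y); try lra;
    intros z; rewrite ?Rmin_left, ?Rmax_right by lra; intros Hz; apply H0; lra. }
rewrite <- E; now apply (RInt_correct h), ex_RInt_cont.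
Qed.

(** * Test functions, and the distributions of continuous functions *)

Lemma tf_ex_derive (phi : test_function) (x : R) : ex_derive phi x.
Proof. exact (tf_smooth phi 1 x). Qed.

Lemma tf_continuous (phi : test_function) (x : R) : continuous phi x.
Proof. apply (ex_derive_continuous phi), tf_ex_derive. Qed.

Lemma tf_Derive_continuous (phi : test_function) (x : R) :
  continuous (Derive phi) x.
Proof. apply (ex_derive_continuous (Derive phi)), (tf_smooth phi 2 x). Qed.

Lemma locally_Rabs_gt (M x : R) : M < Rabs x -> locally x (fun y => M < Rabs y).
Proof.
intros Hx; apply (continuous_Rabs x (fun r => M < r)).
now apply (open_gt M).
Qed.

(** The bound for the derivative holds on the closed set [M <= Rabs x] because
    [M] is taken beyond the given bound on the support. *)
Lemma tf_bounded_support (phi : test_function) :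
  exists M, 0 < M /\
    forall x, M <= Rabs x -> phi x = 0 /\ Derive phi x = 0.
Proof.
destruct (tf_support phi) as [M HM].
exists (Rmax M 0 + 1); split; [assert (H := Rmax_r M 0); lra|].
intros x Hx; assert (Hx' : M < Rabs x) by (assert (H := Rmax_l M 0); lra).
split; [now apply HM|].
rewrite (Derive_ext_loc phi (fun _ => 0)); [apply Derive_const|].
now apply (filter_imp _ _ HM), locally_Rabs_gt.
Qed.

Lemma int_line_tf (h : R -> R) (phi : test_function) (M : R) :
  0 < M -> (forall x, continuous h x) ->
  (forall x, M <= Rabs x -> phi x = 0) ->
  int_line (fun t => h t * phi t) = RInt (fun t => h t * phi t) (- M) M.
Proof.
intros HM Hc H0; apply int_line_compact; [lra| |].
- intros x; apply (continuous_mult h phi); [apply Hc|apply tf_continuous].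
- intros x Hx; rewrite H0; [ring|].
  destruct Hx; [rewrite Rabs_left | rewrite Rabs_right]; lra.
Qed.

Lemma int_line_tf_derive (h : R -> R) (phi : test_function) (M : R) :
  0 < M -> (forall x, continuous h x) ->
  (forall x, M <= Rabs x -> Derive phi x = 0) ->
  int_line (fun t => h t * Derive phi t) =
  RInt (fun t => h t * Derive phi t) (- M) M.
Proof.
intros HM Hc H0; apply int_line_compact; [lra| |].
- intros x; apply (continuous_mult h (Derive phi));
    [apply Hc|apply tf_Derive_continuous].
- intros x Hx; rewrite H0; [ring|].
  destruct Hx; [rewrite Rabs_left | rewrite Rabs_right]; lra.
Qed.

Lemma int_line_tf_linear (h : R -> R) (a b : R) (phi psi chi : test_function) :
  (forall x, continuous h x) ->
  (forall x, chi x = a * phi x + b * psi x) ->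
  int_line (fun t => h t * chi t) =
  a * int_line (fun t => h t * phi t) + b * int_line (fun t => h t * psi t).
Proof.
intros Hh Hchi.
destruct (tf_bounded_support phi) as [M1 [HM1 H1]].
destruct (tf_bounded_support psi) as [M2 [HM2 H2]].
set (M := Rmax M1 M2).
assert (HMl : M1 <= M) by apply Rmax_l.
assert (HMr : M2 <= M) by apply Rmax_r.
assert (Hphi : forall x, M <= Rabs x -> phi x = 0) by (intros; apply H1; lra).
assert (Hpsi : forall x, M <= Rabs x -> psi x = 0) by (intros; apply H2; lra).
rewrite (int_line_tf h phi M), (int_line_tf h psi M), (int_line_tf h chi M);
  trivial; try lra.
2: { intros x Hx; rewrite Hchi, Hphi, Hpsi by trivial; ring. }
assert (C : forall xi : test_function,
          forall x, continuous (fun t => h t * xi t) x).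
{ intros xi x; apply (continuous_mult h xi); [apply Hh|apply tf_continuous]. }
etransitivity; [|apply (RInt_lin _ _ a b (- M) M (C phi) (C psi))].
apply RInt_eq; intros x; rewrite Hchi; ring.
Qed.

Lemma continuous_bounded (h : R -> R) (a b : R) :
  (forall x, continuous h x) ->
  exists B, 0 < B /\ forall x, a <= x <= b -> Rabs (h x) <= B.
Proof.
intros Hh; destruct (Rle_lt_dec a b) as [Hab|Hab].
- destruct (continuity_ab_maj (fun x => Rabs (h x)) a b Hab) as [m [Hm _]].
  { intros c _; apply continuity_pt_filterlim.
    apply (continuous_comp h Rabs); [apply Hh|apply continuous_Rabs]. }
  exists (Rabs (h m) + 1); split; [assert (H := Rabs_pos (h m)); lra|].
  intros x Hx; assert (H := Hm x Hx); lra.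
- exists 1; split; [lra|]; intros x Hx; lra.
Qed.

Lemma int_line_tf_cvg (h : R -> R) (phi : nat -> test_function)
    (psi : test_function) :
  (forall x, continuous h x) -> tf_cvg phi psi ->
  filterlim (fun j => int_line (fun t => h t * phi j t)) eventually
    (locally (int_line (fun t => h t * psi t))).
Proof.
intros Hh [[M0 HM0] Hcv].
destruct (tf_bounded_support psi) as [M1 [HM1 H1]].
set (M := Rmax (M0 + 1) M1).
assert (HMl : M0 + 1 <= M) by apply Rmax_l.
assert (HMr : M1 <= M) by apply Rmax_r.
assert (Hpsi : forall x, M <= Rabs x -> psi x = 0) by (intros; apply H1; lra).
assert (Hphi : forall j x, M <= Rabs x -> phi j x = 0)
  by (intros; apply HM0; lra).
assert (C : forall xi : test_function,
          forall x, continuous (fun t => h t * xi t) x).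
{ intros xi x; apply (continuous_mult h xi); [apply Hh|apply tf_continuous]. }
destruct (continuous_bounded h (- M) M Hh) as [B [HB HhB]].
apply filterlim_locally; intros eps.
assert (Heps : 0 < eps / (4 * M * B)).
{ apply Rdiv_lt_0_compat; [apply eps|].
  apply Rmult_lt_0_compat; lra. }
apply (filter_imp (F := eventually) _ _) with (2 := Hcv 0%nat (mkposreal _ Heps)).
intros j Hj; change (Rabs (int_line (fun t => h t * phi j t) -
  int_line (fun t => h t * psi t)) < eps).
rewrite (int_line_tf h (phi j) M), (int_line_tf h psi M); trivial; try lra.
2: apply Hphi.
assert (E : RInt (fun t => h t * phi j t) (- M) M -
            RInt (fun t => h t * psi t) (- M) M =
            RInt (fun t => h t * (phi j t - psi t)) (- M) M).
{ replace (RInt (fun t => h t * phi j t) (- M) M -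
            RInt (fun t => h t * psi t) (- M) M)
    with (1 * RInt (fun t => h t * phi j t) (- M) M +
          (-1) * RInt (fun t => h t * psi t) (- M) M) by ring.
  etransitivity;
    [symmetry; apply (RInt_lin _ _ 1 (-1) (- M) M (C (phi j)) (C psi))|].
  apply RInt_eq; intros x; ring. }
rewrite E.
apply Rle_lt_trans with ((M - - M) * (B * (eps / (4 * M * B)))).
- apply abs_RInt_le_const; [lra| |].
  + apply ex_RInt_cont; intros x; apply (continuous_mult h); [apply Hh|].
    apply (continuous_minus (phi j) psi); apply tf_continuous.
  + intros t Ht; rewrite Rabs_mult.
    apply Rmult_le_compat; try apply Rabs_pos; [now apply HhB|].
    apply Rlt_le, (Hj t).
- replace ((M - - M) * (B * (eps / (4 * M * B)))) with (eps / 2)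
    by (field; lra).
  assert (H := cond_pos eps); lra.
Qed.

Lemma dist_of_distribution (h : R -> C) :
  (forall x, continuous (fun t => Re (h t)) x) ->
  (forall x, continuous (fun t => Im (h t)) x) ->
  is_distribution (dist_of h).
Proof.
intros HRe HIm; split.
- intros a b phi psi chi Hchi; unfold dist_of.
  rewrite (int_line_tf_linear (fun t => Re (h t)) a b phi psi chi),
          (int_line_tf_linear (fun t => Im (h t)) a b phi psi chi); trivial.
  apply injective_projections; simpl; ring.
- intros phi psi Hcv.
  apply filterlim_locally; intros eps; unfold dist_of.
  generalize (filter_and _ _
    (proj1 (filterlim_locally _ _)
       (int_line_tf_cvg (fun t => Re (h t)) phi psi HRe Hcv) eps)
    (proj1 (filterlim_locally _ _)
       (int_line_tf_cvg (fun t => Im (h t)) phi psi HIm Hcv) eps)).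
  apply filter_imp; intros j Hj; exact Hj.
Qed.

(** Integration by parts; the boundary terms vanish with the test function. *)
Lemma dist_of_derivative (h : R -> C) (G : R -> R) (phi : test_function) :
  (forall x, is_derive G x (Re (h x))) ->
  (forall x, continuous (fun t => Re (h t)) x) ->
  (forall x, Im (h x) = 0) ->
  dist_of h phi = dist_derive G phi.
Proof.
intros HG HRe HIm.
assert (HGc : forall x, continuous G x).
{ intros x; apply (ex_derive_continuous G); now exists (Re (h x)). }
destruct (tf_bounded_support phi) as [M [HM H0]].
apply injective_projections; simpl.
2: { rewrite (int_line_compact _ 0 0); [now rewrite RInt_point|lra| |].
     - intros x; apply (continuous_ext (fun _ => 0)); [|apply continuous_const].
       intros t; rewrite HIm; symmetry; apply Rmult_0_l.
     - intros x _; rewrite HIm; apply Rmult_0_l. }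
rewrite (int_line_tf (fun t => Re (h t)) phi M),
        (int_line_tf_derive G phi M); trivial;
  try (intros x Hx; now apply H0).
assert (C1 : forall x, continuous (fun t => Re (h t) * phi t) x).
{ intros x; apply (continuous_mult _ phi); [apply HRe|apply tf_continuous]. }
assert (C2 : forall x, continuous (fun t => G t * Derive phi t) x).
{ intros x; apply (continuous_mult G); [apply HGc|apply tf_Derive_continuous]. }
assert (E : is_RInt (fun t => 1 * (Re (h t) * phi t) + 1 * (G t * Derive phi t))
              (- M) M (minus (G M * phi M) (G (- M) * phi (- M)))).
{ apply (is_RInt_derive (fun t => G t * phi t)); intros x _.
  - rewrite !Rmult_1_l.
    apply (is_derive_mult G phi x (Re (h x)) (Derive phi x)).
    + apply HG.
    + apply Derive_correct, tf_ex_derive.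
    + exact Rmult_comm.
  - apply (continuous_plus (V := R_NormedModule));
      apply (continuous_scal_r (V := R_NormedModule)); auto. }
apply (is_RInt_unique (V := R_CompleteNormedModule)) in E.
rewrite (RInt_lin _ _ 1 1 (- M) M C1 C2) in E.
rewrite (proj1 (H0 M ltac:(rewrite Rabs_right; lra))) in E.
rewrite (proj1 (H0 (- M) ltac:(rewrite Rabs_left; lra))) in E.
change (1 * RInt (fun t => Re (h t) * phi t) (- M) M +
        1 * RInt (fun t => G t * Derive phi t) (- M) M =
        G M * 0 - G (- M) * 0) in E.
lra.
Qed.

(** * Bump functions and uniqueness of the primitive *)

(** Differentiability [n] times, with the derivative as a witness rather than
    through [Derive], so that the product rule is an immediate induction. *)
Fixpoint Ck (n : nat) (f : R -> R) : Prop :=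
  match n with
  | 0%nat => True
  | S m => exists f', (forall x, is_derive f x (f' x)) /\ Ck m f'
  end.

Lemma Ck_pred (n : nat) : forall f, Ck (S n) f -> Ck n f.
Proof.
induction n as [|n IH]; intros f [f' [Hf Hf']]; [exact I|].
exists f'; split; [exact Hf|now apply IH].
Qed.

Lemma Ck_ext (n : nat) (f g : R -> R) : (forall x, f x = g x) -> Ck n f -> Ck n g.
Proof.
destruct n as [|n]; [easy|]; intros E [f' [Hf Hf']].
exists f'; split; [|exact Hf'].
intros x; apply (is_derive_ext f); auto.
Qed.

Lemma Ck_plus (n : nat) : forall f g, Ck n f -> Ck n g ->
  Ck n (fun x => f x + g x).
Proof.
induction n as [|n IH]; intros f g; [easy|]; intros [f' [Hf Hf']] [g' [Hg Hg']].
exists (fun x => f' x + g' x); split; [|now apply IH].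
intros x; now apply (is_derive_plus f g).
Qed.

Lemma Ck_scal (c : R) (n : nat) : forall f, Ck n f -> Ck n (fun x => c * f x).
Proof.
induction n as [|n IH]; intros f; [easy|]; intros [f' [Hf Hf']].
exists (fun x => c * f' x); split; [|now apply IH].
intros x; now apply (is_derive_scal f).
Qed.

Lemma Ck_mult (n : nat) : forall f g, Ck n f -> Ck n g ->
  Ck n (fun x => f x * g x).
Proof.
induction n as [|n IH]; intros f g; [easy|]; intros Hf Hg.
assert (Hf0 := Ck_pred _ _ Hf); assert (Hg0 := Ck_pred _ _ Hg).
destruct Hf as [f' [Hf Hf']], Hg as [g' [Hg Hg']].
exists (fun x => f' x * g x + f x * g' x); split.
- intros x; apply (is_derive_mult f g); [apply Hf|apply Hg|exact Rmult_comm].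
- apply Ck_plus; now apply IH.
Qed.

Lemma Ck_comp_affine (c d : R) (n : nat) : forall f, Ck n f ->
  Ck n (fun x => f (c * x + d)).
Proof.
induction n as [|n IH]; intros f; [easy|]; intros [f' [Hf Hf']].
exists (fun x => c * f' (c * x + d)); split.
- intros x; apply (is_derive_comp f (fun y => c * y + d)); [apply Hf|].
  auto_derive; trivial; ring.
- apply (Ck_scal c n (fun x => f' (c * x + d))); now apply IH.
Qed.

Lemma Ck_ex_derive_n (n : nat) : forall f, Ck n f -> forall x, ex_derive_n f n x.
Proof.
induction n as [|n IH]; intros f; [easy|]; intros [f' [Hf Hf']] x.
destruct n as [|n]; [now exists (f' x)|].
change (ex_derive (Derive_n f (S n)) x).
apply ex_derive_ext with (f := Derive_n f' n).
- intros t; replace (S n) with (n + 1)%nat by lia.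
  rewrite <- Derive_n_comp; apply Derive_n_ext.
  intros s; symmetry; apply is_derive_unique, Hf.
- exact (IH f' Hf' x).
Qed.

(** The derivatives of the flat exponential [exp (- 1 / x)] are combinations of
    these functions, so the whole family is differentiated at once. *)
Definition flat (m : nat) (x : R) : R :=
  if Rlt_dec 0 x then (/ x) ^ m * exp (- / x) else 0.

(** One term of the exponential series bounds [exp y] below. *)
Lemma pow_exp_neg_bound (m : nat) (y : R) :
  0 < y -> y ^ m * exp (- y) <= INR (fact (S m)) * / y.
Proof.
intros Hy.
assert (H : y ^ S m / INR (fact (S m)) <= exp y).
{ apply Rle_trans with (sum_f_R0 (fun k => y ^ k / INR (fact k)) (S m)).
  - rewrite tech5.
    assert (0 <= sum_f_R0 (fun k => y ^ k / INR (fact k)) m).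
    { apply cond_pos_sum; intros k; apply Rlt_le, Rdiv_lt_0_compat;
        [now apply pow_lt|apply INR_fact_lt_0]. }
    lra.
  - now apply exp_ge_taylor, Rlt_le. }
assert (Hf := INR_fact_lt_0 (S m)); assert (He := exp_pos y).
rewrite exp_Ropp.
apply (Rmult_le_reg_r (exp y * y)); [now apply Rmult_lt_0_compat|].
replace (y ^ m * / exp y * (exp y * y)) with (y ^ S m) by (simpl; field; lra).
replace (INR (fact (S m)) * / y * (exp y * y))
  with (INR (fact (S m)) * exp y) by (field; lra).
apply (Rmult_le_reg_l (/ INR (fact (S m)))); [now apply Rinv_0_lt_compat|].
rewrite <- Rmult_assoc, Rinv_l, Rmult_1_l by lra.
unfold Rdiv in H; lra.
Qed.

Lemma flat_bound (m : nat) (x : R) :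
  0 <= flat m x <= INR (fact (S m)) * Rabs x.
Proof.
assert (Hf := INR_fact_lt_0 (S m)); assert (Ha := Rabs_pos x).
unfold flat; destruct (Rlt_dec 0 x) as [Hx|Hx].
- assert (Hi := Rinv_0_lt_compat x Hx); split.
  + apply Rmult_le_pos; [now apply pow_le, Rlt_le|apply Rlt_le, exp_pos].
  + rewrite Rabs_right by lra.
    rewrite <- (Rinv_inv x) at 3; now apply pow_exp_neg_bound.
- split; [lra|]; apply Rmult_le_pos; lra.
Qed.

Lemma flat_derive (m : nat) (x : R) :
  is_derive (flat m) x (flat (S (S m)) x + - INR m * flat (S m) x).
Proof.
destruct (Rtotal_order x 0) as [Hx|[->|Hx]].
- apply (is_derive_ext_loc (fun _ => 0)).
  { apply (filter_imp (fun y => y < 0)); [|now apply (open_lt 0)].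
    intros y Hy; unfold flat; destruct (Rlt_dec 0 y); [lra|easy]. }
  replace (flat (S (S m)) x + - INR m * flat (S m) x) with 0.
  2: { unfold flat; destruct (Rlt_dec 0 x); [lra|ring]. }
  apply (is_derive_const (V := R_NormedModule) 0 x).
- (* the difference quotient at [0] is [flat (S m)], which tends to [0] *)
  replace (flat (S (S m)) 0 + - INR m * flat (S m) 0) with 0.
  2: { unfold flat; destruct (Rlt_dec 0 0); [lra|ring]. }
  apply is_derive_Reals; intros eps Heps.
  assert (Hf := INR_fact_lt_0 (S (S m))).
  assert (Hd : 0 < eps / INR (fact (S (S m)))) by now apply Rdiv_lt_0_compat.
  exists (mkposreal _ Hd); intros h Hh Hd'; simpl in Hd'.
  assert (E : (flat m (0 + h) - flat m 0) / h - 0 = flat (S m) h).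
  { unfold flat; rewrite Rplus_0_l; destruct (Rlt_dec 0 0); [lra|].
    destruct (Rlt_dec 0 h); simpl; field; lra. }
  rewrite E; destruct (flat_bound (S m) h) as [H0 H1].
  rewrite Rabs_right by lra; apply Rle_lt_trans with (1 := H1).
  replace eps with (INR (fact (S (S m))) * (eps / INR (fact (S (S m)))))
    by (field; lra).
  now apply Rmult_lt_compat_l.
- apply (is_derive_ext_loc (fun y => (/ y) ^ m * exp (- / y))).
  { apply (filter_imp (fun y => 0 < y)); [|now apply (open_gt 0)].
    intros y Hy; unfold flat; destruct (Rlt_dec 0 y); [easy|lra]. }
  unfold flat; destruct (Rlt_dec 0 x); [|lra].
  auto_derive; [repeat split; lra|].
  destruct m as [|m]; [simpl; field; lra|].
  replace (Nat.pred (S m)) with m by reflexivity.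
  rewrite S_INR; simpl; field; lra.
Qed.

Lemma flat_Ck (n : nat) : forall m, Ck n (flat m).
Proof.
induction n as [|n IH]; intros m; [easy|].
exists (fun x => flat (S (S m)) x + - INR m * flat (S m) x); split.
- apply flat_derive.
- apply Ck_plus; [apply IH|apply Ck_scal, IH].
Qed.

Definition bump (eps x : R) : R := flat 0 x * flat 0 (eps - x).

Lemma bump_Ck (eps : R) (n : nat) : Ck n (bump eps).
Proof.
apply Ck_mult; [apply flat_Ck|].
apply (Ck_ext n (fun x => flat 0 ((-1) * x + eps))).
- intros x; f_equal; ring.
- apply Ck_comp_affine, flat_Ck.
Qed.

Lemma bump_pos (eps x : R) : 0 < x < eps -> 0 < bump eps x.
Proof.
intros Hx; unfold bump, flat.
destruct (Rlt_dec 0 x), (Rlt_dec 0 (eps - x)); try lra.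
simpl; rewrite !Rmult_1_l; apply Rmult_lt_0_compat; apply exp_pos.
Qed.

Lemma bump_out (eps x : R) : x <= 0 \/ eps <= x -> bump eps x = 0.
Proof.
intros Hx; unfold bump, flat.
destruct (Rlt_dec 0 x), (Rlt_dec 0 (eps - x)); lra.
Qed.

Lemma bump_continuous (eps x : R) : continuous (bump eps) x.
Proof.
destruct (bump_Ck eps 1) as [b' [Hb _]].
apply (ex_derive_continuous (bump eps)); now exists (b' x).
Qed.

(** The primitive of the difference of two translates of a bump has compact
    support.  Pairing a function with the derivative of this test function compares
    its averages near [a] and near [b]. *)
Lemma test_function_two_bumps (eps a b : R) :
  0 < eps -> a < b ->
  exists phi : test_function,
    forall x, Derive phi x = bump eps (x - a) - bump eps (x - b).
Proof.
intros Heps Hab.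
set (h := fun x => bump eps (x - a) - bump eps (x - b)).
assert (Hh : forall n, Ck n h).
{ intros n; apply (Ck_ext n
    (fun x => bump eps (1 * x + - a) + (-1) * bump eps (1 * x + - b))).
  - intros x; unfold h; rewrite !Rmult_1_l; unfold Rminus; ring.
  - apply Ck_plus; [|apply (Ck_scal (-1) n (fun x => bump eps (1 * x + - b)))];
      apply (Ck_comp_affine 1 _ n (bump eps)), bump_Ck. }
assert (Hc : forall c x, continuous (fun t => bump eps (t - c)) x).
{ intros c x; apply (continuous_comp (fun t => t - c) (bump eps));
    [|apply bump_continuous].
  apply (continuous_minus (fun t => t) (fun _ => c));
    [apply continuous_id|apply continuous_const]. }
assert (Hhc : forall x, continuous h x).
{ intros x; apply (continuous_minus (fun t => bump eps (t - a))
                     (fun t => bump eps (t - b))); apply Hc. }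
set (P := fun x => RInt h a x).
assert (HP : forall x, is_derive P x (h x)).
{ intros x; apply (is_derive_RInt h P a x).
  - apply filter_forall; intros y.
    now apply (RInt_correct h), ex_RInt_cont.
  - apply Hhc. }
assert (Hshift : forall c y, RInt (fun t => bump eps (t - c)) a y =
                             RInt (bump eps) (a - c) (y - c)).
{ intros c y.
  assert (E := RInt_comp_lin (bump eps) 1 (- c) a y
    (ex_RInt_cont (bump eps) _ _ (bump_continuous eps))).
  replace (1 * a + - c) with (a - c) in E by ring.
  replace (1 * y + - c) with (y - c) in E by ring.
  rewrite <- E; apply RInt_eq; intros t.
  change (bump eps (t - c) = 1 * bump eps (1 * t + - c)).
  rewrite !Rmult_1_l; reflexivity. }
assert (Hsup : forall x, Rabs a + Rabs b + eps < Rabs x -> P x = 0).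
{ intros x Hx.
  assert (Ha := Rle_abs a); assert (Ha' := Rle_abs (- a)).
  assert (Hb := Rle_abs b); assert (Hb' := Rle_abs (- b)).
  rewrite Rabs_Ropp in Ha', Hb'.
  destruct (Rlt_le_dec x 0) as [Hx0|Hx0];
    [rewrite (Rabs_left x) in Hx by lra | rewrite (Rabs_right x) in Hx by lra].
  - apply RInt_null; intros t.
    rewrite Rmin_right, Rmax_left by lra; intros Ht.
    unfold h; rewrite !bump_out by (first [left; lra | right; lra]); ring.
  - assert (E : P x = 1 * RInt (fun t => bump eps (t - a)) a x +
                      (-1) * RInt (fun t => bump eps (t - b)) a x).
    { etransitivity; [|apply (RInt_lin _ _ 1 (-1) a x (Hc a) (Hc b))].
      apply RInt_eq; intros t; unfold h; ring. }
    rewrite E, !Hshift.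
    rewrite <- (RInt_split (bump eps) (a - a) eps (x - a) (bump_continuous eps)).
    rewrite <- (RInt_split (bump eps) (a - b) eps (x - b) (bump_continuous eps)).
    rewrite <- (RInt_split (bump eps) (a - b) 0 eps (bump_continuous eps)).
    rewrite (RInt_null _ eps (x - a)), (RInt_null _ eps (x - b)),
            (RInt_null _ (a - b) 0);
      try (intros t; rewrite Rmin_left, Rmax_right by lra; intros Ht;
           apply bump_out; first [left; lra | right; lra]).
    replace (a - a) with 0 by ring; set (I := RInt (bump eps) 0 eps).
    change (1 * (I + 0) + (-1) * (0 + I + 0) = 0); ring. }
assert (Hsm : forall n x, ex_derive_n P n x).
{ intros n; apply Ck_ex_derive_n; destruct n as [|n]; [exact I|].
  exists h; auto. }
exists (TestFunction P Hsm (ex_intro _ _ Hsup)).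
intros x; apply is_derive_unique, HP.
Qed.

(** If [H a] and [H b] differed, then [H (s + a) - H (s + b)] would keep its sign
    for [0 <= s <= eps] with [eps] small, and the test function built from bumps
    at [a] and [b] would detect it. *)
Lemma du_Bois_Reymond (H : R -> R) :
  (forall x, continuous H x) ->
  (forall phi : test_function, int_line (fun t => H t * Derive phi t) = 0) ->
  forall a b, H a = H b.
Proof.
intros Hc H0.
(* used with [c = 1] and [c = -1], one for each sign of [H a - H b] *)
assert (key : forall c a b, c <> 0 -> a < b -> ~ 0 < c * (H a - H b)).
{ intros c a b Hc0 Hab Hpos.
  set (W := fun s => c * (H (s + a) - H (s + b))).
  assert (Hsh : forall d x, continuous (fun s => H (s + d)) x).
  { intros d x; apply (continuous_comp (fun s => s + d) H); [|apply Hc].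
    apply (continuous_plus (fun s : R => s) (fun _ => d));
      [apply continuous_id|apply continuous_const]. }
  assert (HW : forall x, continuous W x).
  { intros x; apply (continuous_scal_r c (fun s => H (s + a) - H (s + b))).
    apply (continuous_minus (fun s => H (s + a)) (fun s => H (s + b)));
      apply Hsh. }
  assert (HW0 : 0 < W 0) by (unfold W; rewrite !Rplus_0_l; exact Hpos).
  destruct (HW 0 (fun y => 0 < y) (open_gt 0 (W 0) HW0)) as [d Hd].
  set (eps := d / 2).
  assert (Heps : 0 < eps) by (unfold eps; assert (Hp := cond_pos d); lra).
  destruct (test_function_two_bumps eps a b Heps Hab) as [phi Hphi].
  assert (Hbc : forall e x, continuous (fun t => bump eps (t - e)) x).
  { intros e x; apply (continuous_comp (fun t => t - e) (bump eps));
      [|apply bump_continuous].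
    apply (continuous_minus (fun t => t) (fun _ => e));
      [apply continuous_id|apply continuous_const]. }
  assert (Hint : forall e l r, l <= e -> e + eps <= r ->
    RInt (fun t => H t * bump eps (t - e)) l r =
    RInt (fun s => H (s + e) * bump eps s) 0 eps).
  { intros e l r Hl Hr.
    assert (C : forall x, continuous (fun t : R => H t * bump eps (t - e)) x).
    { intros x; apply (continuous_mult H); [apply Hc|apply Hbc]. }
    rewrite <- (RInt_split _ l e r C), <- (RInt_split _ e (e + eps) r C).
    rewrite (RInt_null _ l e), (RInt_null _ (e + eps) r);
      try (intros t; rewrite Rmin_left, Rmax_right by lra; intros Ht;
           rewrite bump_out by (first [left; lra | right; lra]); ring).
    assert (E := RInt_comp_lin (fun t => H t * bump eps (t - e)) 1 e 0 eps
      (ex_RInt_cont _ _ _ C)).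
    replace (1 * 0 + e) with e in E by ring.
    replace (1 * eps + e) with (e + eps) in E by ring.
    rewrite <- E, Rplus_0_l, Rplus_0_r.
    apply RInt_eq; intros s.
    change (1 * (H (1 * s + e) * bump eps (1 * s + e - e)) =
            H (s + e) * bump eps s).
    rewrite !Rmult_1_l; do 2 f_equal; ring. }
  assert (Hline := H0 phi).
  rewrite (int_line_compact _ a (b + eps)) in Hline; [|lra| |].
  2: { intros x; apply (continuous_mult H (Derive phi));
         [apply Hc|apply tf_Derive_continuous]. }
  2: { intros x [Hx|Hx]; rewrite Hphi, !bump_out
         by (first [left; lra | right; lra]);
       apply Rmult_eq_0_compat_l; ring. }
  assert (E : RInt (fun t => H t * Derive phi t) a (b + eps) =
    1 * RInt (fun s => H (s + a) * bump eps s) 0 eps +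
    (-1) * RInt (fun s => H (s + b) * bump eps s) 0 eps).
  { rewrite <- (Hint a a (b + eps)), <- (Hint b a (b + eps)) by lra.
    etransitivity; [|apply RInt_lin].
    - apply RInt_eq; intros t; rewrite Hphi; ring.
    - intros x; apply (continuous_mult H); [apply Hc|apply Hbc].
    - intros x; apply (continuous_mult H); [apply Hc|apply Hbc]. }
  assert (E' : RInt (fun s => W s * bump eps s) 0 eps =
    c * RInt (fun s => H (s + a) * bump eps s) 0 eps +
    (- c) * RInt (fun s => H (s + b) * bump eps s) 0 eps).
  { etransitivity; [|apply RInt_lin].
    - apply RInt_eq; intros t; unfold W; ring.
    - intros x; apply (continuous_mult (fun s => H (s + a)));
        [apply Hsh|apply bump_continuous].
    - intros x; apply (continuous_mult (fun s => H (s + b)));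
        [apply Hsh|apply bump_continuous]. }
  assert (Hgt : 0 < RInt (fun s => W s * bump eps s) 0 eps).
  { apply RInt_gt_0; [exact Heps| |].
    - intros s Hs; apply Rmult_lt_0_compat; [|now apply bump_pos].
      apply Hd; change (Rabs (s - 0) < d).
      rewrite Rminus_0_r, Rabs_right by lra; unfold eps in Hs; lra.
    - intros s _; apply (continuous_mult W); [apply HW|apply bump_continuous]. }
  rewrite E in Hline; rewrite E' in Hgt.
  set (I := RInt (fun s => H (s + a) * bump eps s) 0 eps) in *.
  set (J := RInt (fun s => H (s + b) * bump eps s) 0 eps) in *.
  assert (HIJ : I = J) by lra.
  rewrite HIJ in Hgt; lra. }
assert (lt_case : forall a b, a < b -> H a = H b).
{ intros a b Hab; assert (K1 := key 1 a b ltac:(lra) Hab).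
  assert (K2 := key (-1) a b ltac:(lra) Hab); lra. }
intros a b; destruct (Rtotal_order a b) as [L|[->|L]]; auto.
symmetry; auto.
Qed.

Lemma dist_derive_minus (F G : R -> R) (phi : test_function) :
  (forall x, continuous F x) -> (forall x, continuous G x) ->
  dist_derive (fun x => F x - G x) phi =
  (dist_derive F phi - dist_derive G phi)%C.
Proof.
intros HF HG; destruct (tf_bounded_support phi) as [M [HM H0]].
assert (C : forall H : R -> R, (forall x, continuous H x) ->
          forall x, continuous (fun t => H t * Derive phi t) x).
{ intros H Hc x; apply (continuous_mult H (Derive phi));
    [apply Hc|apply tf_Derive_continuous]. }
unfold dist_derive.
assert (H1 : forall x, M <= Rabs x -> Derive phi x = 0) by (intros; now apply H0).
rewrite (int_line_tf_derive F phi M), (int_line_tf_derive G phi M),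
  (int_line_tf_derive (fun x => F x - G x) phi M); trivial.
2: { intros x; now apply (continuous_minus F G). }
assert (E : RInt (fun t => (F t - G t) * Derive phi t) (- M) M =
  1 * RInt (fun t => F t * Derive phi t) (- M) M +
  (-1) * RInt (fun t => G t * Derive phi t) (- M) M).
{ etransitivity; [|apply RInt_lin; now apply C].
  apply RInt_eq; intros t; ring. }
rewrite E; apply injective_projections; simpl; ring.
Qed.

(** By du Bois-Reymond two primitives differ by a constant, which the
    normalization at [- PI] makes zero. *)
Lemma primitive_unique (f : functional) (F G : R -> R) :
  is_primitive f F -> is_primitive f G -> F = G.
Proof.
intros [[HF [HF0 _]] HfF] [[HG [HG0 _]] HfG].
apply functional_extensionality; intros x.
assert (E : F x - G x = F (- PI) - G (- PI)).
{ apply (du_Bois_Reymond (fun y => F y - G y)).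
  - intros y; now apply (continuous_minus F G).
  - intros phi; assert (E := dist_derive_minus F G phi HF HG).
    rewrite <- HfF, <- HfG in E; apply (f_equal fst) in E; simpl in E; lra. }
rewrite HF0, HG0 in E; lra.
Qed.

Lemma primitive_eq (f : functional) (F : R -> R) :
  is_primitive f F -> Defs.primitive f = F.
Proof.
intros HF; apply (primitive_unique f); [|exact HF].
unfold Defs.primitive; apply epsilon_spec; now exists F.
Qed.

(** * Integrals of products with continuously differentiable functions *)

Definition is_C1 (g : R -> R) : Prop :=
  (forall x, ex_derive g x) /\ (forall x, continuous (Derive g) x).

Lemma C1_continuous (g : R -> R) : is_C1 g -> forall x, continuous g x.
Proof. intros Hg x; apply (ex_derive_continuous g), Hg. Qed.

Lemma C1_intro (g g' : R -> R) :
  (forall x, is_derive g x (g' x)) -> (forall x, continuous g' x) -> is_C1 g.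
Proof.
intros Hg Hg'; split; intros x; [now exists (g' x)|].
apply (continuous_ext g'); [|apply Hg'].
intros t; symmetry; apply is_derive_unique, Hg.
Qed.

Lemma C1_ext (g h : R -> R) : (forall t, g t = h t) -> is_C1 g -> is_C1 h.
Proof. intros E; now rewrite (functional_extensionality g h E). Qed.

Lemma C1_lin (c d : R) (g h : R -> R) :
  is_C1 g -> is_C1 h -> is_C1 (fun x => c * g x + d * h x).
Proof.
intros [Hg Hg'] [Hh Hh'].
apply (C1_intro _ (fun x => c * Derive g x + d * Derive h x)); intros x.
- apply (is_derive_plus (fun x => c * g x) (fun x => d * h x));
    apply is_derive_scal, Derive_correct; trivial.
- apply (continuous_plus (fun x => c * Derive g x) (fun x => d * Derive h x)).
  + apply (continuous_scal_r c (Derive g)), Hg'.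
  + apply (continuous_scal_r d (Derive h)), Hh'.
Qed.

Lemma Derive_lin (c d : R) (g h : R -> R) (x : R) :
  is_C1 g -> is_C1 h ->
  Derive (fun x => c * g x + d * h x) x = c * Derive g x + d * Derive h x.
Proof.
intros [Hg _] [Hh _]; apply is_derive_unique.
apply (is_derive_plus (fun x => c * g x) (fun x => d * h x));
  apply is_derive_scal, Derive_correct; trivial.
Qed.

Lemma Derive_reflect (g : R -> R) (x t : R) :
  ex_derive g (x - t) -> is_derive (fun s => g (x - s)) t (- Derive g (x - t)).
Proof.
intros Hg.
replace (- Derive g (x - t)) with (scal (-1) (Derive g (x - t)))
  by (change ((-1) * Derive g (x - t) = - Derive g (x - t)); ring).
apply (is_derive_comp g (fun s => x - s)); [now apply Derive_correct|].
auto_derive; trivial; ring.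
Qed.

Lemma continuous_reflect (F : R -> R) (x : R) :
  (forall t, continuous F t) -> forall t, continuous (fun s : R => F (x - s)) t.
Proof.
intros HF t; apply (continuous_comp (fun s => x - s) F); [|apply HF].
apply (continuous_minus (fun _ : R => x) (fun s => s));
  [apply continuous_const|apply continuous_id].
Qed.

Lemma C1_reflect (g : R -> R) (x : R) : is_C1 g -> is_C1 (fun t => g (x - t)).
Proof.
intros [Hg Hg']; apply (C1_intro _ (fun t => - Derive g (x - t))); intros t.
- now apply Derive_reflect.
- apply (continuous_opp (fun t => Derive g (x - t))).
  now apply continuous_reflect.
Qed.

Lemma RInt_Derive_C1 (g : R -> R) (a b : R) :
  is_C1 g -> RInt (Derive g) a b = g b - g a.
Proof. intros [Hg Hg']; apply RInt_Derive; auto. Qed.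

Lemma continuous_mult_Derive (F g : R -> R) :
  (forall x, continuous F x) -> is_C1 g ->
  forall x : R, continuous (fun t : R => F t * Derive g t) x.
Proof.
intros HF Hg x; apply (continuous_mult F (Derive g)); [apply HF|apply Hg].
Qed.

Lemma RS_sum_cons (F g : R -> R) (h : R * R) (s : @SF_seq R) :
  RS_sum F g (SF_cons h s) =
  F (snd h) * (g (SF_h s) - g (fst h)) + RS_sum F g s.
Proof.
unfold RS_sum; simpl; f_equal; now destruct (SF_t s).
Qed.

Lemma pointed_subdiv_head (h : R * R) (s : @SF_seq R) :
  pointed_subdiv (SF_cons h s) -> fst h <= snd h <= SF_h s.
Proof.
intros H; apply (H 0%nat); rewrite SF_size_cons; lia.
Qed.

Lemma pointed_subdiv_le_last (s : @SF_seq R) :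
  pointed_subdiv s -> SF_h s <= seq.last (SF_h s) (SF_lx s).
Proof.
induction s as [x|h s IH] using SF_cons_ind; intros Hs; [apply Rle_refl|].
assert (H := pointed_subdiv_head _ _ Hs).
assert (H' := IH (ptd_cons _ _ Hs)).
apply Rle_trans with (SF_h s); [simpl; lra|exact H'].
Qed.

(** On each cell the sum and the integral differ by the integral of
    [(F t - F s) * g' s], [t] the tag, which the oscillation of [F] controls. *)
Lemma RS_sum_close (F g : R -> R) (a b B eps delta : R) (s : @SF_seq R) :
  (forall x, continuous F x) -> is_C1 g ->
  (forall x, a <= x <= b -> Rabs (Derive g x) <= B) ->
  (forall x y, a <= x <= b -> a <= y <= b -> Rabs (x - y) < delta ->
     Rabs (F x - F y) <= eps) ->
  pointed_subdiv s -> a <= SF_h s -> seq.last (SF_h s) (SF_lx s) <= b ->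
  seq_step (SF_lx s) < delta ->
  Rabs (RS_sum F g s - RInt (fun t => F t * Derive g t)
                         (SF_h s) (seq.last (SF_h s) (SF_lx s))) <=
  (seq.last (SF_h s) (SF_lx s) - SF_h s) * (eps * B).
Proof.
intros HF Hg HB Hosc.
induction s as [x|h s IH] using SF_cons_ind; intros Hs Ha Hb Hstep.
{ simpl; rewrite RInt_point; change (Rabs (0 - 0) <= (x - x) * (eps * B)).
  rewrite Rminus_diag, Rabs_R0; lra. }
assert (H := pointed_subdiv_head _ _ Hs).
assert (Hs' := ptd_cons _ _ Hs).
assert (Hl := pointed_subdiv_le_last _ Hs').
rewrite RS_sum_cons.
change (seq.last (SF_h (SF_cons h s)) (SF_lx (SF_cons h s)))
  with (seq.last (SF_h s) (SF_lx s)) in *.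
change (SF_h (SF_cons h s)) with (fst h) in *.
change (seq_step (SF_lx (SF_cons h s)))
  with (Rmax (Rabs (SF_h s - fst h)) (seq_step (SF_lx s))) in Hstep.
assert (Hstep1 := Rle_lt_trans _ _ _ (Rmax_l _ _) Hstep).
assert (Hstep2 := Rle_lt_trans _ _ _ (Rmax_r _ _) Hstep).
specialize (IH Hs' ltac:(lra) Hb Hstep2).
set (l := seq.last (SF_h s) (SF_lx s)) in *.
assert (C := continuous_mult_Derive F g HF Hg).
rewrite <- (RInt_split _ (fst h) (SF_h s) l C).
assert (E : F (snd h) * (g (SF_h s) - g (fst h)) -
  RInt (fun t => F t * Derive g t) (fst h) (SF_h s) =
  RInt (fun t => (F (snd h) - F t) * Derive g t) (fst h) (SF_h s)).
{ rewrite <- (RInt_Derive_C1 g (fst h) (SF_h s) Hg).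
  transitivity (F (snd h) * RInt (Derive g) (fst h) (SF_h s) +
    (-1) * RInt (fun t => F t * Derive g t) (fst h) (SF_h s)); [ring|].
  etransitivity; [symmetry; apply RInt_lin; [apply Hg|exact C]|].
  apply RInt_eq; intros t; ring. }
assert (Hcell : Rabs (RInt (fun t => (F (snd h) - F t) * Derive g t)
                  (fst h) (SF_h s)) <= (SF_h s - fst h) * (eps * B)).
{ apply abs_RInt_le_const; [lra| |].
  - apply ex_RInt_cont, (continuous_mult_Derive (fun t => F (snd h) - F t));
      [|exact Hg].
    intros x; apply (continuous_minus (fun _ : R => F (snd h)) F);
      [apply continuous_const|apply HF].
  - intros t Ht; rewrite Rabs_mult.
    apply Rmult_le_compat; try apply Rabs_pos; [|apply HB; lra].
    apply Hosc; try lra.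
    rewrite Rabs_right in Hstep1 by lra; apply Rabs_def1; lra. }
set (I1 := RInt (fun t => F t * Derive g t) (fst h) (SF_h s)) in *.
set (I2 := RInt (fun t => F t * Derive g t) (SF_h s) l) in *.
replace (F (snd h) * (g (SF_h s) - g (fst h)) + RS_sum F g s - (I1 + I2))
  with ((F (snd h) * (g (SF_h s) - g (fst h)) - I1) + (RS_sum F g s - I2))
  by ring.
rewrite E.
apply Rle_trans with (1 := Rabs_triang _ _); lra.
Qed.

Lemma continuous_Heine (F : R -> R) (a b : R) :
  (forall x, continuous F x) -> forall eps : posreal,
  exists delta : posreal, forall x y,
    a <= x <= b -> a <= y <= b -> Rabs (x - y) < delta -> Rabs (F x - F y) < eps.
Proof.
intros HF eps; destruct (Heine_cor2 (f := F) (a := a) (b := b)) with (eps := eps)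
  as [delta Hd]; [|now exists delta].
intros x _; apply continuity_pt_filterlim, HF.
Qed.

Lemma is_RSInt_C1 (F g : R -> R) (a b : R) :
  a <= b -> (forall x, continuous F x) -> is_C1 g ->
  is_RSInt F g a b (RInt (fun t => F t * Derive g t) a b).
Proof.
intros Hab HF Hg; apply filterlim_locally; intros eps.
destruct (continuous_bounded (Derive g) a b) as [B [HB HgB]]; [apply Hg|].
(* [b - a + 1] rather than [b - a], since [a = b] is allowed *)
assert (He : 0 < eps / ((b - a + 1) * B)).
{ apply Rdiv_lt_0_compat; [apply eps|apply Rmult_lt_0_compat; lra]. }
destruct (continuous_Heine F a b HF (mkposreal _ He)) as [delta Hd].
exists delta; intros s Hstep [Hs [Hh Hl]].
rewrite Rmin_left in Hh by exact Hab; rewrite Rmax_right in Hl by exact Hab.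
change (Rabs (RS_sum F g s - RInt (fun t => F t * Derive g t) a b) < eps).
assert (K := RS_sum_close F g a b B (eps / ((b - a + 1) * B)) delta s HF Hg HgB).
rewrite Hl, Hh in K.
apply Rle_lt_trans with ((b - a) * (eps / ((b - a + 1) * B) * B)).
- apply K; trivial; try apply Rle_refl.
  intros x y Hx Hy Hxy; now apply Rlt_le, Hd.
- replace ((b - a) * (eps / ((b - a + 1) * B) * B))
    with ((b - a) * (eps / (b - a + 1))) by (field; lra).
  apply Rlt_le_trans with ((b - a + 1) * (eps / (b - a + 1))).
  + apply Rmult_lt_compat_r; [|lra].
    apply Rdiv_lt_0_compat; [apply eps|lra].
  + right; field; lra.
Qed.

Lemma RSInt_C1 (F g : R -> R) (a b : R) :
  a <= b -> (forall x, continuous F x) -> is_C1 g ->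
  RSInt F g a b = RInt (fun t => F t * Derive g t) a b.
Proof.
intros Hab HF Hg; apply (iota_filterlim_locally (RS_sum F g)).
now apply is_RSInt_C1.
Qed.

(** This turns every pairing of the theorem into a Riemann integral. *)
Lemma int_mul_re_C1 (f : functional) (F g : R -> R) :
  is_primitive f F -> is_C1 g ->
  int_mul_re f g = F PI * g PI - RInt (fun t => F t * Derive g t) (- PI) PI.
Proof.
intros HF Hg; unfold int_mul_re; rewrite (primitive_eq f F HF).
assert (Hpi := PI_RGT_0); rewrite RSInt_C1; trivial; [lra|apply HF].
Qed.

Lemma int_mul_re_lin (f : functional) (F g h : R -> R) (c d : R) :
  is_primitive f F -> is_C1 g -> is_C1 h ->
  int_mul_re f (fun t => c * g t + d * h t) =
  c * int_mul_re f g + d * int_mul_re f h.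
Proof.
intros HF Hg Hh.
rewrite !(int_mul_re_C1 f F) by (trivial; now apply C1_lin).
assert (C := fun k => continuous_mult_Derive F k (proj1 (proj1 HF))).
assert (E : RInt (fun t => F t * Derive (fun t => c * g t + d * h t) t)
              (- PI) PI =
  c * RInt (fun t => F t * Derive g t) (- PI) PI +
  d * RInt (fun t => F t * Derive h t) (- PI) PI).
{ etransitivity; [|apply RInt_lin; now apply C].
  apply RInt_eq; intros t; rewrite Derive_lin by trivial; ring. }
rewrite E; ring.
Qed.

Definition C1_complex (g : R -> C) : Prop :=
  is_C1 (fun t => Re (g t)) /\ is_C1 (fun t => Im (g t)).

Lemma C1_complex_ext (g h : R -> C) :
  (forall t, g t = h t) -> C1_complex g -> C1_complex h.
Proof. intros E; now rewrite (functional_extensionality g h E). Qed.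

Lemma int_mul_ext (f : functional) (g h : R -> C) :
  (forall t, g t = h t) -> int_mul f g = int_mul f h.
Proof. intros E; now rewrite (functional_extensionality g h E). Qed.

Lemma C1_complex_plus (g h : R -> C) :
  C1_complex g -> C1_complex h -> C1_complex (fun t => g t + h t)%C.
Proof.
intros [Hg Hg'] [Hh Hh']; split.
- apply (C1_ext _ _) with (2 := C1_lin 1 1 _ _ Hg Hh).
  intros t; simpl; unfold Re; ring.
- apply (C1_ext _ _) with (2 := C1_lin 1 1 _ _ Hg' Hh').
  intros t; simpl; unfold Im; ring.
Qed.

Lemma C1_complex_scal (c : C) (g : R -> C) :
  C1_complex g -> C1_complex (fun t => c * g t)%C.
Proof.
intros [Hg Hg']; split.
- apply (C1_ext _ _) with (2 := C1_lin (fst c) (- snd c) _ _ Hg Hg').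
  intros t; simpl; unfold Re, Im; ring.
- apply (C1_ext _ _) with (2 := C1_lin (fst c) (snd c) _ _ Hg' Hg).
  intros t; simpl; unfold Re, Im; ring.
Qed.

Lemma int_mul_plus (f : functional) (F : R -> R) (g h : R -> C) :
  is_primitive f F -> C1_complex g -> C1_complex h ->
  int_mul f (fun t => g t + h t)%C = (int_mul f g + int_mul f h)%C.
Proof.
intros HF [Hg Hg'] [Hh Hh']; unfold int_mul.
apply injective_projections; simpl.
- transitivity (1 * int_mul_re f (fun t => Re (g t)) +
    1 * int_mul_re f (fun t => Re (h t))); [|ring].
  rewrite <- (int_mul_re_lin f F) by assumption.
  f_equal; apply functional_extensionality; intros t; unfold Re; simpl; ring.
- transitivity (1 * int_mul_re f (fun t => Im (g t)) +
    1 * int_mul_re f (fun t => Im (h t))); [|ring].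
  rewrite <- (int_mul_re_lin f F) by assumption.
  f_equal; apply functional_extensionality; intros t; unfold Im; simpl; ring.
Qed.

Lemma int_mul_scal (f : functional) (F : R -> R) (c : C) (g : R -> C) :
  is_primitive f F -> C1_complex g ->
  int_mul f (fun t => c * g t)%C = (c * int_mul f g)%C.
Proof.
intros HF [Hg Hg']; unfold int_mul.
apply injective_projections; simpl.
- transitivity (fst c * int_mul_re f (fun t => Re (g t)) +
    (- snd c) * int_mul_re f (fun t => Im (g t))); [|ring].
  rewrite <- (int_mul_re_lin f F) by assumption.
  f_equal; apply functional_extensionality; intros t; unfold Re, Im; simpl; ring.
- transitivity (fst c * int_mul_re f (fun t => Im (g t)) +
    snd c * int_mul_re f (fun t => Re (g t))); [|ring].
  rewrite <- (int_mul_re_lin f F) by assumption.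
  f_equal; apply functional_extensionality; intros t; unfold Re, Im; simpl; ring.
Qed.

Lemma C1_complex_sum_n (a : nat -> R -> C) (N : nat) :
  (forall j, C1_complex (a j)) -> C1_complex (fun t => sum_n (fun j => a j t) N).
Proof.
intros Ha; induction N as [|N IH].
- apply (C1_complex_ext (a 0%nat)); [|apply Ha].
  intros t; now rewrite sum_O.
- apply (C1_complex_ext
    (fun t => sum_n (fun j => a j t) N + a (S N) t)%C);
    [|now apply C1_complex_plus].
  intros t; now rewrite sum_Sn.
Qed.

Lemma int_mul_sum_n (f : functional) (F : R -> R) (a : nat -> R -> C) (N : nat) :
  is_primitive f F -> (forall j, C1_complex (a j)) ->
  int_mul f (fun t => sum_n (fun j => a j t) N) =
  sum_n (fun j => int_mul f (a j)) N.
Proof.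
intros HF Ha; induction N as [|N IH].
- rewrite sum_O; apply int_mul_ext; intros t; now rewrite sum_O.
- rewrite sum_Sn, <- IH.
  change (plus ?u ?v) with (u + v)%C.
  rewrite <- (int_mul_plus f F); trivial; [|now apply C1_complex_sum_n].
  apply int_mul_ext; intros t; now rewrite sum_Sn.
Qed.

(** * Convolution with a continuously differentiable periodic kernel *)

Lemma circle_representative (x : R) :
  exists (y : R) (n : Z), - PI <= y < PI /\ x = y + 2 * IZR n * PI.
Proof.
assert (Hpi := PI_RGT_0).
set (r := (x + PI) / (2 * PI)).
assert (Hr : x + PI = r * (2 * PI)) by (unfold r; field; lra).
destruct (base_Int_part r) as [H1 H2]; set (n := Int_part r) in *.
exists (x - 2 * IZR n * PI), n; split; [|ring].
assert (IZR n * (2 * PI) <= r * (2 * PI)) by (apply Rmult_le_compat_r; lra).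
assert (r * (2 * PI) < (IZR n + 1) * (2 * PI))
  by (apply Rmult_lt_compat_r; lra).
split; lra.
Qed.

Lemma Bc_translate (F : R -> R) (x : R) (n : Z) :
  Bc F -> F (x + 2 * IZR n * PI) = F x + IZR n * F PI.
Proof.
intros [_ [_ HF]]; destruct (circle_representative x) as [y [m [Hy ->]]].
rewrite (HF y m Hy).
replace (y + 2 * IZR m * PI + 2 * IZR n * PI) with (y + 2 * IZR (m + n) * PI)
  by (rewrite plus_IZR; ring).
rewrite (HF y _ Hy), plus_IZR; ring.
Qed.

Lemma Bc_translate_1 (F : R -> R) (x : R) :
  Bc F -> F (x + 2 * PI) = F x + F PI.
Proof.
intros HF; assert (E := Bc_translate F x 1 HF).
rewrite Rmult_1_l, Rmult_1_r in E; exact E.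
Qed.

Lemma RInt_reflect (h : R -> R) (x a b : R) :
  (forall t, continuous h t) ->
  RInt (fun s => h (x - s)) a b = RInt h (x - b) (x - a).
Proof.
intros Hh.
assert (E := RInt_comp_lin h (-1) x a b (ex_RInt_cont h _ _ Hh)).
replace (-1 * a + x) with (x - a) in E by ring.
replace (-1 * b + x) with (x - b) in E by ring.
rewrite <- (opp_RInt_swap h (x - a) (x - b)) by now apply ex_RInt_cont.
rewrite <- E; symmetry.
change (- RInt (fun y => -1 * h (-1 * y + x)) a b =
        RInt (fun s => h (x - s)) a b).
assert (C := continuous_reflect h x Hh).
rewrite <- (RInt_eq (fun s => -1 * h (x - s)) (fun y => -1 * h (-1 * y + x))),
  (RInt_scale _ (-1) a b C).
- ring.
- intros t; do 2 f_equal; ring.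
Qed.

(** The primitive of [f o r_x] comes from the substitution [s = x - t]; the
    constant [F (x + PI)] normalizes it to vanish at [- PI]. *)
Lemma reflect_primitive (f : functional) (F : R -> R) (x : R) :
  is_primitive f F ->
  is_primitive (dist_reflect x f) (fun s => F (x + PI) - F (x - s)).
Proof.
intros [HF Hf].
assert (Hc := proj1 HF).
assert (Hcr := continuous_reflect F x Hc).
split; [split; [|split]|].
- intros s; apply (continuous_minus (fun _ : R => F (x + PI)) (fun s => F (x - s)));
    [apply continuous_const|apply Hcr].
- replace (x - - PI) with (x + PI) by ring; ring.
- intros y n _.
  replace (x - (y + 2 * IZR n * PI)) with (x - y + 2 * IZR (- n) * PI)
    by (rewrite opp_IZR; ring).
  rewrite (Bc_translate F _ _ HF), opp_IZR.
  replace (x + PI) with (x - PI + 2 * PI) by ring.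
  rewrite (Bc_translate_1 F _ HF); ring.
- intros phi; unfold dist_reflect; rewrite Hf; unfold dist_derive; f_equal.
  f_equal.
  destruct (tf_bounded_support phi) as [M [HM H0]].
  assert (HD : forall t, Derive (tf_reflect x phi) t = - Derive phi (x - t)).
  { intros t; apply is_derive_unique, Derive_reflect, tf_ex_derive. }
  assert (H1 : forall t, M <= Rabs t -> Derive phi t = 0) by (intros; now apply H0).
  assert (Cphi := tf_Derive_continuous phi).
  set (h := fun s => F (x - s) * Derive phi s).
  assert (Ch : forall s, continuous h s).
  { intros s; apply (continuous_mult (fun s => F (x - s)) (Derive phi));
      [apply Hcr|apply Cphi]. }
  assert (L : int_line (fun t => F t * Derive (tf_reflect x phi) t) =
              - RInt h (- M) M).
  { set (N := M + Rabs x).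
    assert (Hx := Rabs_pos x).
    assert (Hx1 := Rle_abs x); assert (Hx2 := Rle_abs (- x)).
    rewrite Rabs_Ropp in Hx2.
    rewrite (int_line_tf_derive F (tf_reflect x phi) N); trivial;
      [|unfold N; lra|].
    2: { intros t Ht; rewrite HD, H1; [ring|].
         assert (K := Rabs_triang_inv t x); rewrite Rabs_minus_sym in K.
         unfold N in Ht; lra. }
    assert (C := continuous_reflect h x Ch).
    rewrite <- (RInt_eq (fun t => (-1) * h (x - t))), (RInt_scale _ (-1) _ _ C).
    2: { intros t; rewrite HD; unfold h.
         replace (x - (x - t)) with t by ring; ring. }
    rewrite (RInt_reflect h x _ _ Ch).
    rewrite <- (RInt_split h (x - N) (- M) (x - - N) Ch).
    rewrite <- (RInt_split h (- M) M (x - - N) Ch).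
    assert (Z : forall t, M <= Rabs t -> h t = 0).
    { intros t Ht; unfold h; rewrite H1 by exact Ht; ring. }
    rewrite (RInt_null h (x - N) (- M)), (RInt_null h M (x - - N)); [lra|..];
      intros t; rewrite Rmin_left, Rmax_right by (unfold N; lra); intros Ht;
      apply Z; [rewrite Rabs_right | rewrite Rabs_left]; lra. }
  rewrite L.
  rewrite (int_line_tf_derive (fun s => F (x + PI) - F (x - s)) phi M HM);
    [|intros s; apply (continuous_minus (fun _ : R => F (x + PI))
         (fun s => F (x - s))); [apply continuous_const|apply Hcr]|exact H1].
  assert (E : RInt (fun s => (F (x + PI) - F (x - s)) * Derive phi s) (- M) M =
    F (x + PI) * RInt (Derive phi) (- M) M + (-1) * RInt h (- M) M).
  { etransitivity; [|apply (RInt_lin _ _ _ _ _ _ Cphi Ch)].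
    apply RInt_eq; intros s; unfold h; ring. }
  rewrite E, (RInt_Derive_C1 phi (- M) M) by (split; [apply tf_ex_derive|exact Cphi]).
  rewrite (proj1 (H0 M ltac:(rewrite Rabs_right; lra))).
  rewrite (proj1 (H0 (- M) ltac:(rewrite Rabs_left; lra))).
  ring.
Qed.

Lemma periodic_Derive (g : R -> R) (T x : R) :
  (forall t, ex_derive g t) -> (forall t, g (t + T) = g t) ->
  Derive g (x + T) = Derive g x.
Proof.
intros Hg HT.
transitivity (Derive (fun t => g (t + T)) x); [|now apply Derive_ext].
symmetry; apply is_derive_unique.
replace (Derive g (x + T)) with (scal 1 (Derive g (x + T)))
  by apply (Rmult_1_l (Derive g (x + T))).
apply (is_derive_comp g (fun t => t + T)).
- now apply Derive_correct.
- auto_derive; trivial; ring.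
Qed.

(** Sliding the window by [x] drops the integral of [F t * h' t] from [- PI] to
    [x - PI] and adds, after a translation by [2 PI], that of
    [F (t + 2 PI) * h' t = (F t + F PI) * h' t]; the excess
    [F PI * (h (x - PI) - h (- PI))] is what the boundary term absorbs. *)
Lemma window_invariance (F h : R -> R) (x : R) :
  Bc F -> is_C1 h -> (forall t, h (t + 2 * PI) = h t) ->
  F PI * h (x + PI) - RInt (fun t => F t * Derive h t) (x - PI) (x + PI) =
  F PI * h PI - RInt (fun t => F t * Derive h t) (- PI) PI.
Proof.
intros HF Hh Hp.
assert (HFc := proj1 HF).
assert (C := continuous_mult_Derive F h HFc Hh).
set (u := fun t => F t * Derive h t) in *.
assert (E : RInt u PI (x + PI) =
  1 * RInt u (- PI) (x - PI) + F PI * RInt (Derive h) (- PI) (x - PI)).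
{ etransitivity; [|apply (RInt_lin _ _ _ _ _ _ C (proj2 Hh))].
  assert (E := RInt_comp_lin u 1 (2 * PI) (- PI) (x - PI) (ex_RInt_cont u _ _ C)).
  replace (1 * - PI + 2 * PI) with PI in E by ring.
  replace (1 * (x - PI) + 2 * PI) with (x + PI) in E by ring.
  rewrite <- E; apply RInt_eq; intros t.
  change (1 * (F (1 * t + 2 * PI) * Derive h (1 * t + 2 * PI)) =
          1 * (F t * Derive h t) + F PI * Derive h t).
  rewrite !Rmult_1_l, (Bc_translate_1 F _ HF), (periodic_Derive h _ _ (proj1 Hh) Hp).
  ring. }
rewrite (RInt_Derive_C1 h _ _ Hh) in E.
assert (E1 := RInt_split u (- PI) (x - PI) (x + PI) C).
assert (E2 := RInt_split u (- PI) PI (x + PI) C).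
assert (P1 : h (x + PI) = h (x - PI)) by (rewrite <- (Hp (x - PI)); f_equal; ring).
assert (P2 : h PI = h (- PI)) by (rewrite <- (Hp (- PI)); f_equal; ring).
rewrite P1, P2; lra.
Qed.

(** Both sides pair [F] with [h = g (x - .)], over the windows
    [[x - PI, x + PI]] and [[- PI, PI]]. *)
Lemma int_mul_re_reflect (f : functional) (F g : R -> R) (x : R) :
  is_primitive f F -> is_C1 g -> (forall t, g (t + 2 * PI) = g t) ->
  int_mul_re (dist_reflect x f) g = int_mul_re f (fun t => g (x - t)).
Proof.
intros HF Hg Hp.
assert (Hh := C1_reflect g x Hg).
assert (HBc := proj1 HF); assert (HFc := proj1 HBc).
rewrite (int_mul_re_C1 _ _ _ (reflect_primitive f F x HF) Hg).
rewrite (int_mul_re_C1 f F _ HF Hh).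
rewrite <- (window_invariance F _ x HBc Hh).
2: { intros t; rewrite <- (Hp (x - (t + 2 * PI))); f_equal; ring. }
set (u := fun t => F t * Derive (fun t => g (x - t)) t).
assert (Cu : forall t, continuous u t) by now apply continuous_mult_Derive.
assert (E : RInt (fun t => (F (x + PI) - F (x - t)) * Derive g t) (- PI) PI =
  F (x + PI) * RInt (Derive g) (- PI) PI +
  1 * RInt (fun t => u (x - t)) (- PI) PI).
{ etransitivity;
    [|apply (RInt_lin _ _ _ _ _ _ (proj2 Hg) (continuous_reflect u x Cu))].
  apply RInt_eq; intros t; unfold u.
  assert (D : Derive (fun t : R => g (x - t)) (x - t) = - Derive g t).
  { apply is_derive_unique.
    replace (Derive g t) with (Derive g (x - (x - t))) by (f_equal; ring).
    apply Derive_reflect, Hg. }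
  rewrite D; ring. }
rewrite E, (RInt_reflect u x _ _ Cu), (RInt_Derive_C1 g _ _ Hg).
replace (x - - PI) with (x + PI) by ring.
replace (x - (x + PI)) with (- PI) by ring.
assert (P1 : g PI = g (- PI)) by (rewrite <- (Hp (- PI)); f_equal; ring).
assert (P2 : F (x + PI) = F (x - PI) + F PI).
{ rewrite <- (Bc_translate_1 F _ HBc); f_equal; ring. }
rewrite P1, P2; unfold u; ring.
Qed.

(** The convolution of [k] with the primitive [F]: up to a constant, it is the
    primitive of the convolution of [k] with [F']. *)
Definition conv_primitive (k F : R -> R) (x : R) : R :=
  RInt (fun s => F (x - s) * k s) (- PI) PI.

Lemma continuity_2d_pt_snd (h : R -> R) (x y : R) :
  continuous h y -> continuity_2d_pt (fun _ v => h v) x y.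
Proof.
intros Hh; apply continuity_2d_pt_filterlim.
apply (continuous_comp (fun z : R * R => snd z) h); [apply continuous_snd|exact Hh].
Qed.

Lemma continuity_2d_pt_diff (h : R -> R) (x y : R) :
  continuous h (x - y) -> continuity_2d_pt (fun u v => h (u - v)) x y.
Proof.
intros Hh; apply continuity_2d_pt_filterlim.
apply (continuous_comp (fun z : R * R => fst z - snd z) h); [|exact Hh].
apply (continuous_minus (fun z : R * R => fst z) (fun z => snd z));
  [apply continuous_fst|apply continuous_snd].
Qed.

(** Written as the integral of [F u * k (x - u)] over [[x - PI, x + PI]], the
    convolution is differentiated under the integral sign although [F] is only
    continuous.  The two boundary terms combine to [F PI * k PI]. *)
Lemma conv_primitive_derive (f : functional) (F k : R -> R) (x : R) :
  is_primitive f F -> is_C1 k -> (forall t, k (t + 2 * PI) = k t) ->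
  is_derive (conv_primitive k F) x (int_mul_re (dist_reflect x f) k).
Proof.
intros HF Hk Hp.
assert (HBc := proj1 HF); assert (HFc := proj1 HBc).
rewrite (int_mul_re_reflect f F k x HF Hk Hp).
assert (Hh := C1_reflect k x Hk).
rewrite (int_mul_re_C1 f F _ HF Hh).
rewrite <- (window_invariance F _ x HBc Hh).
2: { intros t; rewrite <- (Hp (x - (t + 2 * PI))); f_equal; ring. }
assert (Cw : forall y : R, forall t : R, continuous (fun u : R => F u * k (y - u)) t).
{ intros y t; apply (continuous_mult F (fun u => k (y - u)));
    [apply HFc|apply continuous_reflect, C1_continuous, Hk]. }
apply (is_derive_ext (fun y => RInt (fun u => F u * k (y - u)) (y - PI) (y + PI))).
{ intros y; unfold conv_primitive.
  rewrite <- (RInt_eq (fun s => F (y - s) * k (y - (y - s)))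
                      (fun s => F (y - s) * k s)).
  2: { intros s; do 2 f_equal; ring. }
  etransitivity;
    [|symmetry; apply (RInt_reflect (fun u => F u * k (y - u)) y _ _ (Cw y))].
  f_equal; ring. }
assert (D : forall z v, is_derive (fun y => F v * k (y - v)) z
                          (F v * Derive k (z - v))).
{ intros z v; apply (is_derive_scal (fun y => k (y - v))).
  replace (Derive k (z - v)) with (scal 1 (Derive k (z - v)))
    by apply (Rmult_1_l (Derive k (z - v))).
  apply (is_derive_comp k (fun y => y - v)).
  - apply Derive_correct, Hk.
  - auto_derive; trivial; ring. }
assert (C2 : forall y v, continuity_2d_pt
          (fun u v => Derive (fun z => F v * k (z - v)) u) y v).
{ intros y v; apply (continuity_2d_pt_ext (fun u v => F v * Derive k (u - v))).
  - intros u w; symmetry; apply is_derive_unique, D.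
  - apply continuity_2d_pt_mult; [apply continuity_2d_pt_snd, HFc|].
    apply continuity_2d_pt_diff, Hk. }
assert (Cp : forall y, continuity_pt (fun t => F t * k (x - t)) y).
{ intros y; apply continuity_pt_filterlim, Cw. }
assert (G := is_derive_RInt_param_bound_comp (fun y u => F u * k (y - u))
  (fun y => y - PI) (fun y => y + PI) x 1 1).
match type of G with _ -> _ -> _ -> _ -> _ -> _ -> _ -> _ -> _ -> _ -> _ ->
  is_derive _ _ ?d => replace (F PI * k (x - (x + PI)) -
    RInt (fun t => F t * Derive (fun t => k (x - t)) t) (x - PI) (x + PI)) with d
end.
- apply G.
  + apply filter_forall; intros y; apply ex_RInt_cont, Cw.
  + exists (mkposreal 1 Rlt_0_1); apply filter_forall; intros y.
    apply ex_RInt_cont, Cw.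
  + exists (mkposreal 1 Rlt_0_1); apply filter_forall; intros y.
    apply ex_RInt_cont, Cw.
  + auto_derive; trivial; ring.
  + auto_derive; trivial; ring.
  + exists (mkposreal 1 Rlt_0_1); apply filter_forall; intros y t _.
    eexists; apply D.
  + intros t _; apply C2.
  + apply locally_2d_forall; intros; apply C2.
  + apply locally_2d_forall; intros; apply C2.
  + apply Cp.
  + apply Cp.
- assert (E : RInt (fun t => F t * Derive (fun t => k (x - t)) t) (x - PI) (x + PI)
    = (-1) * RInt (fun t => Derive (fun u => F t * k (u - t)) x) (x - PI) (x + PI)).
  { etransitivity; [|apply RInt_scale].
    - apply RInt_eq; intros t.
      assert (D1 : Derive (fun u : R => F t * k (u - t)) x =
                   F t * Derive k (x - t)) by apply is_derive_unique, D.
      assert (D2 : Derive (fun s : R => k (x - s)) t = - Derive k (x - t))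
        by apply is_derive_unique, Derive_reflect, Hk.
      rewrite D1, D2; ring.
    - intros t.
      apply (continuous_ext (fun v => F v * Derive k (x - v))).
      + intros v; symmetry; apply is_derive_unique, D.
      + apply (continuous_mult F (fun v => Derive k (x - v)));
          [apply HFc|apply continuous_reflect, Hk]. }
  rewrite E.
  replace (x - (x - PI)) with PI by ring.
  replace (x - (x + PI)) with (- PI) by ring.
  assert (P1 : k PI = k (- PI)) by (rewrite <- (Hp (- PI)); f_equal; ring).
  assert (P2 : F (x + PI) = F (x - PI) + F PI).
  { rewrite <- (Bc_translate_1 F _ HBc); f_equal; ring. }
  rewrite P1, P2; ring.
Qed.

(** * Symmetric trigonometric sums *)

Lemma sum_sym_O (a : Z -> C) : sum_sym 0 a = a 0%Z.
Proof. exact (sum_O (fun j => a (Z.of_nat j - Z.of_nat 0)%Z)). Qed.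

Lemma sum_sym_S (n : nat) (a : Z -> C) :
  sum_sym (S n) a =
  (sum_sym n a + (a (Z.of_nat (S n)) + a (- Z.of_nat (S n))%Z))%C.
Proof.
unfold sum_sym; replace (2 * S n)%nat with (S (S (2 * n))) by lia.
rewrite sum_Sn; unfold sum_n; rewrite sum_Sn_m by lia; rewrite <- sum_n_m_S.
rewrite (sum_n_m_ext _ (fun j => a (Z.of_nat j - Z.of_nat n)%Z))
  by (intros j; f_equal; lia).
replace (Z.of_nat 0 - Z.of_nat (S n))%Z with (- Z.of_nat (S n))%Z by lia.
replace (Z.of_nat (S (S (2 * n))) - Z.of_nat (S n))%Z with (Z.of_nat (S n)) by lia.
repeat change (plus ?u ?v) with (u + v)%C; ring.
Qed.

Lemma sum_sym_ext (n : nat) (a b : Z -> C) :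
  (forall k, a k = b k) -> sum_sym n a = sum_sym n b.
Proof. intros E; now rewrite (functional_extensionality a b E). Qed.

Lemma sum_sym_scal (n : nat) (c : C) (a : Z -> C) :
  sum_sym n (fun k => c * a k)%C = (c * sum_sym n a)%C.
Proof.
induction n as [|n IH]; [now rewrite !sum_sym_O|].
rewrite !sum_sym_S, IH; ring.
Qed.

Lemma cis_plus (x y : R) : cis (x + y) = (cis x * cis y)%C.
Proof.
apply injective_projections; simpl; [apply cos_plus|].
rewrite sin_plus; ring.
Qed.

Lemma cis_periodic (k : Z) (t : R) : cis (IZR k * (t + 2 * PI)) = cis (IZR k * t).
Proof.
rewrite Rmult_plus_distr_l.
assert (P : forall (m : nat) x, cis (x + INR m * (2 * PI)) = cis x).
{ intros m x; replace (INR m * (2 * PI)) with (2 * INR m * PI) by ring.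
  unfold cis; now rewrite cos_period, sin_period. }
destruct (Z_le_dec 0 k) as [Hk|Hk].
- rewrite <- (Z2Nat.id k) at 2 by exact Hk.
  rewrite <- INR_IZR_INZ; apply P.
- rewrite <- (P (Z.to_nat (- k))).
  rewrite INR_IZR_INZ, Z2Nat.id, opp_IZR by lia; f_equal; ring.
Qed.

Lemma C1_complex_cis (c d : R) : C1_complex (fun t => cis (c * t + d)).
Proof.
split; simpl.
- apply (C1_intro _ (fun t => - c * sin (c * t + d))); intros t.
  + auto_derive; trivial; ring.
  + apply (ex_derive_continuous (fun t => - c * sin (c * t + d))).
    auto_derive; trivial.
- apply (C1_intro _ (fun t => c * cos (c * t + d))); intros t.
  + auto_derive; trivial; ring.
  + apply (ex_derive_continuous (fun t => c * cos (c * t + d))).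
    auto_derive; trivial.
Qed.

Lemma C1_complex_cis_int (k : Z) : C1_complex (fun t => cis (IZR k * t)).
Proof.
apply (C1_complex_ext (fun t => cis (IZR k * t + 0))); [|apply C1_complex_cis].
intros t; now rewrite Rplus_0_r.
Qed.

Lemma C1_complex_cis_opp (k : Z) : C1_complex (fun t => cis (- (IZR k * t))).
Proof.
apply (C1_complex_ext (fun t => cis (- IZR k * t + 0))); [|apply C1_complex_cis].
intros t; f_equal; ring.
Qed.

Lemma C1_complex_sum_sym (n : nat) (a : Z -> R -> C) :
  (forall k, C1_complex (a k)) -> C1_complex (fun t => sum_sym n (fun k => a k t)).
Proof.
intros Ha.
exact (C1_complex_sum_n (fun j => a (Z.of_nat j - Z.of_nat n)%Z) (2 * n)
         (fun j => Ha _)).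
Qed.

Lemma int_mul_sum_sym (f : functional) (F : R -> R) (n : nat) (a : Z -> R -> C) :
  is_primitive f F -> (forall k, C1_complex (a k)) ->
  int_mul f (fun t => sum_sym n (fun k => a k t)) =
  sum_sym n (fun k => int_mul f (a k)).
Proof.
intros HF Ha.
exact (int_mul_sum_n f F (fun j => a (Z.of_nat j - Z.of_nat n)%Z) (2 * n) HF
         (fun j => Ha _)).
Qed.

(** * The Fejer kernel *)

Definition cos_sum (n : nat) (w : Z -> R) (t : R) : R :=
  Re (sum_sym n (fun k => RtoC (w k) * cis (IZR k * t)))%C.

Lemma cos_sum_O (w : Z -> R) (t : R) : cos_sum 0 w t = w 0%Z.
Proof.
unfold cos_sum; rewrite sum_sym_O; simpl; rewrite Rmult_0_l, cos_0; ring.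
Qed.

Lemma cos_sum_S (n : nat) (w : Z -> R) (t : R) :
  cos_sum (S n) w t = cos_sum n w t +
    (w (Z.of_nat (S n)) + w (- Z.of_nat (S n))%Z) * cos (INR (S n) * t).
Proof.
unfold cos_sum; rewrite sum_sym_S, opp_IZR, <- INR_IZR_INZ.
set (c := INR (S n)); unfold Re; simpl.
replace (- c * t) with (- (c * t)) by ring; rewrite cos_neg; ring.
Qed.

Lemma sin_sum_even (n : nat) (w : Z -> R) (t : R) :
  (forall k, w (- k)%Z = w k) ->
  Im (sum_sym n (fun k => RtoC (w k) * cis (IZR k * t)))%C = 0.
Proof.
intros Hw; induction n as [|n IH].
- rewrite sum_sym_O; simpl; rewrite Rmult_0_l, sin_0; ring.
- rewrite sum_sym_S, Hw, opp_IZR; set (c := IZR (Z.of_nat (S n))).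
  set (s := sum_sym n _) in *; clearbody s.
  unfold Im in *; simpl; rewrite IH.
  replace (- c * t) with (- (c * t)) by ring; rewrite sin_neg; ring.
Qed.

Lemma cos_sum_plus (n : nat) (v w : Z -> R) (t : R) :
  cos_sum n (fun k => v k + w k) t = cos_sum n v t + cos_sum n w t.
Proof.
induction n as [|n IH]; [now rewrite !cos_sum_O|].
rewrite !cos_sum_S, IH; ring.
Qed.

Lemma cos_sum_scal (n : nat) (c : R) (w : Z -> R) (t : R) :
  cos_sum n (fun k => c * w k) t = c * cos_sum n w t.
Proof.
induction n as [|n IH]; [now rewrite !cos_sum_O|].
rewrite !cos_sum_S, IH; ring.
Qed.

Lemma cos_sum_ext (n : nat) (v w : Z -> R) (t : R) :
  (forall k, v k = w k) -> cos_sum n v t = cos_sum n w t.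
Proof. intros E; now rewrite (functional_extensionality v w E). Qed.

Lemma cos_sum_continuous (n : nat) (w : Z -> R) (t : R) :
  continuous (cos_sum n w) t.
Proof.
apply C1_continuous, (C1_complex_sum_sym n
  (fun k t => RtoC (w k) * cis (IZR k * t))%C).
intros k; apply C1_complex_scal, C1_complex_cis_int.
Qed.

Lemma cos_INR_continuous (m : nat) (t : R) : continuous (fun s => cos (INR m * s)) t.
Proof.
apply (ex_derive_continuous (fun s => cos (INR m * s))); auto_derive; trivial.
Qed.

Lemma sin_INR_PI (m : nat) : sin (INR m * PI) = 0.
Proof.
induction m as [|m IH]; [simpl; rewrite Rmult_0_l; apply sin_0|].
rewrite S_INR, Rmult_plus_distr_r, Rmult_1_l, neg_sin, IH; ring.
Qed.

Lemma RInt_cos_INR (m : nat) :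
  RInt (fun t => cos (INR (S m) * t)) (- PI) PI = 0.
Proof.
assert (Hm : INR (S m) <> 0) by (apply not_0_INR; lia).
assert (D : forall t, is_derive (fun t => sin (INR (S m) * t) / INR (S m)) t
                        (cos (INR (S m) * t))).
{ intros t; set (c := INR (S m)) in *; auto_derive; [trivial|field; exact Hm]. }
transitivity (sin (INR (S m) * PI) / INR (S m) - sin (INR (S m) * - PI) / INR (S m)).
- apply is_RInt_unique, (is_RInt_derive (fun t => sin (INR (S m) * t) / INR (S m))).
  + intros t _; apply D.
  + intros t _; apply cos_INR_continuous.
- replace (INR (S m) * - PI) with (- (INR (S m) * PI)) by ring.
  rewrite sin_neg, sin_INR_PI; apply Rminus_diag_eq; field; exact Hm.
Qed.

Lemma RInt_cos_sum (n : nat) (w : Z -> R) :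
  RInt (cos_sum n w) (- PI) PI = 2 * PI * w 0%Z.
Proof.
induction n as [|n IH].
- rewrite (RInt_eq _ (fun _ => w 0%Z)) by (intros t; apply cos_sum_O).
  rewrite RInt_const; change ((PI - - PI) * w 0%Z = 2 * PI * w 0%Z); ring.
- set (c := w (Z.of_nat (S n)) + w (- Z.of_nat (S n))%Z).
  rewrite (RInt_eq _ (fun t => 1 * cos_sum n w t + c * cos (INR (S n) * t))).
  + rewrite (RInt_lin _ _ _ _ _ _ (cos_sum_continuous n w) (cos_INR_continuous (S n))).
    rewrite IH, RInt_cos_INR, Rmult_1_l, Rmult_0_r; apply Rplus_0_r.
  + intros t; rewrite cos_sum_S; fold c; ring.
Qed.

(** The factor [1 - cos t] makes the sum telescope, and is kept on the left since it
    vanishes at the multiples of [2 PI]. *)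
Lemma dirichlet_sum (n : nat) (t : R) :
  cos_sum n (fun _ => 1) t * (1 - cos t) = cos (INR n * t) - cos (INR (S n) * t).
Proof.
induction n as [|n IH].
- rewrite cos_sum_O; simpl; rewrite Rmult_0_l, cos_0, !Rmult_1_l; reflexivity.
- rewrite cos_sum_S, Rmult_plus_distr_r, IH.
  set (c := INR (S n)).
  replace (INR n * t) with (c * t - t) by (unfold c; rewrite S_INR; ring).
  replace (INR (S (S n)) * t) with (c * t + t)
    by (unfold c; rewrite (S_INR (S n)); ring).
  rewrite cos_minus, cos_plus; ring.
Qed.

(** [INR n + 1] times the coefficients of the Fejer kernel: scaled this way the
    weights for [n] and [S n] differ by [1], so that the Fejer sums are the partial
    sums of the Dirichlet sums. *)
Definition fejer_weight (n : nat) (k : Z) : R := INR n + 1 - IZR (Z.abs k).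

Lemma fejer_sum_S (n : nat) (t : R) :
  cos_sum (S n) (fejer_weight (S n)) t =
  cos_sum n (fejer_weight n) t + cos_sum (S n) (fun _ => 1) t.
Proof.
rewrite !cos_sum_S.
rewrite (cos_sum_ext n (fejer_weight (S n)) (fun k => fejer_weight n k + 1)).
2: { intros k; unfold fejer_weight; rewrite S_INR; ring. }
rewrite cos_sum_plus; unfold fejer_weight at 2 3.
rewrite Z.abs_opp, (Z.abs_eq (Z.of_nat (S n))) by lia.
rewrite <- INR_IZR_INZ; ring.
Qed.

Lemma fejer_sum (n : nat) (t : R) :
  cos_sum n (fejer_weight n) t * (1 - cos t) = 1 - cos (INR (S n) * t).
Proof.
induction n as [|n IH].
- rewrite cos_sum_O; unfold fejer_weight; simpl; rewrite Rmult_1_l; ring.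
- rewrite fejer_sum_S, Rmult_plus_distr_r, IH, dirichlet_sum; ring.
Qed.

Lemma cos_multiple_1 (m : nat) (t : R) : cos t = 1 -> cos (INR m * t) = 1.
Proof.
intros Hc.
assert (Hs : sin t = 0).
{ assert (K := sin2_cos2 t); rewrite Hc in K; unfold Rsqr in K.
  apply Rsqr_0_uniq; unfold Rsqr; lra. }
induction m as [|m IH]; [simpl; rewrite Rmult_0_l; apply cos_0|].
rewrite S_INR, Rmult_plus_distr_r, Rmult_1_l, cos_plus, IH, Hc, Hs; ring.
Qed.

(** The closed form settles the sign except where [cos t = 1]; there all the
    cosines equal [1] and the sums are sums of nonnegative numbers. *)
Lemma fejer_sum_pos (n : nat) (t : R) : 0 <= cos_sum n (fejer_weight n) t.
Proof.
destruct (Rlt_le_dec (cos t) 1) as [Hc|Hc].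
- apply (Rmult_le_reg_r (1 - cos t)); [lra|].
  rewrite fejer_sum, Rmult_0_l; assert (H := COS_bound (INR (S n) * t)); lra.
- assert (H1 : cos t = 1) by (assert (H := COS_bound t); lra).
  assert (D : forall m, 0 <= cos_sum m (fun _ => 1) t).
  { induction m as [|m IH]; [rewrite cos_sum_O; lra|].
    rewrite cos_sum_S, (cos_multiple_1 _ _ H1); lra. }
  induction n as [|n IH].
  + rewrite cos_sum_O; unfold fejer_weight; simpl; lra.
  + rewrite fejer_sum_S; assert (K := D (S n)); lra.
Qed.

Definition fejer_re (n : nat) (t : R) : R := Re (fejer n t).

Lemma fejer_C1 (n : nat) : C1_complex (fejer n).
Proof.
apply C1_complex_scal, (C1_complex_sum_sym n
  (fun k t => RtoC (1 - IZR (Z.abs k) / (INR n + 1)) * cis (IZR k * t))%C).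
intros k; apply C1_complex_scal, C1_complex_cis_int.
Qed.

Lemma fejer_periodic (n : nat) (t : R) : fejer n (t + 2 * PI) = fejer n t.
Proof.
unfold fejer; f_equal; apply sum_sym_ext; intros k; now rewrite cis_periodic.
Qed.

Lemma fejer_im (n : nat) (t : R) : Im (fejer n t) = 0.
Proof.
assert (E := sin_sum_even n (fun k => 1 - IZR (Z.abs k) / (INR n + 1)) t
  (fun k => f_equal (fun m => 1 - IZR m / (INR n + 1)) (Z.abs_opp k))).
unfold fejer; set (s := sum_sym n _) in *; clearbody s; unfold Im in *; simpl.
rewrite E; ring.
Qed.

Lemma fejer_re_weighted (n : nat) (t : R) :
  fejer_re n t =
  / (2 * PI) * cos_sum n (fun k => 1 - IZR (Z.abs k) / (INR n + 1)) t.
Proof.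
unfold fejer_re, fejer, cos_sum; unfold Re; simpl; ring.
Qed.

Lemma fejer_re_sum (n : nat) (t : R) :
  fejer_re n t =
  / (2 * PI * (INR n + 1)) * cos_sum n (fejer_weight n) t.
Proof.
assert (Hpi := PI_RGT_0); assert (Hn := pos_INR n).
rewrite fejer_re_weighted.
rewrite (cos_sum_ext n _ (fun k => / (INR n + 1) * fejer_weight n k)).
- rewrite cos_sum_scal; field; lra.
- intros k; unfold fejer_weight; field; lra.
Qed.

Lemma fejer_re_pos (n : nat) (t : R) : 0 <= fejer_re n t.
Proof.
assert (Hpi := PI_RGT_0); assert (Hn := pos_INR n).
rewrite fejer_re_sum; apply Rmult_le_pos; [|apply fejer_sum_pos].
apply Rlt_le, Rinv_0_lt_compat, Rmult_lt_0_compat; lra.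
Qed.

Lemma fejer_re_continuous (n : nat) (t : R) : continuous (fejer_re n) t.
Proof. exact (C1_continuous (fejer_re n) (proj1 (fejer_C1 n)) t). Qed.

Lemma RInt_fejer (n : nat) : RInt (fejer_re n) (- PI) PI = 1.
Proof.
assert (Hpi := PI_RGT_0); assert (Hn := pos_INR n).
rewrite (RInt_eq _ _ _ _ (fejer_re_weighted n)).
rewrite (RInt_scale _ _ _ _ (cos_sum_continuous n _)), RInt_cos_sum.
simpl; field; lra.
Qed.

(** The weight [1 - cos s] measures the distance to [0] on the circle, so the decay
    of this moment says that the mass of the kernel concentrates at [0].  By
    [fejer_sum] the integrand is a multiple of [1 - cos ((n + 1) s)]. *)
Lemma RInt_fejer_moment (n : nat) :
  RInt (fun s => (1 - cos s) * fejer_re n s) (- PI) PI = / (INR n + 1).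
Proof.
assert (Hpi := PI_RGT_0); assert (Hn := pos_INR n).
set (c := / (2 * PI * (INR n + 1))).
rewrite (RInt_eq _ (fun s => c * 1 + (- c) * cos (INR (S n) * s))).
- rewrite (RInt_lin _ _ _ _ _ _ (fun t => continuous_const 1 t)
             (cos_INR_continuous (S n))).
  rewrite RInt_cos_INR, RInt_const.
  change (c * ((PI - - PI) * 1) + - c * 0 = / (INR n + 1)).
  unfold c; field; lra.
- intros s; rewrite fejer_re_sum; fold c.
  transitivity (c * (cos_sum n (fejer_weight n) s * (1 - cos s))); [ring|].
  rewrite fejer_sum; ring.
Qed.

(** * The Fejer means as trigonometric polynomials *)

Lemma conv_eq_int_mul (f : functional) (F : R -> R) (g : R -> C) (x : R) :
  is_primitive f F -> C1_complex g -> (forall t, g (t + 2 * PI) = g t) ->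
  conv g f x = int_mul f (fun t => g (x - t)).
Proof.
intros HF [Hg Hg'] Hp; unfold conv, int_mul.
rewrite (int_mul_re_reflect f F (fun t => Re (g t)) x HF Hg)
  by (intros; now rewrite Hp).
rewrite (int_mul_re_reflect f F (fun t => Im (g t)) x HF Hg')
  by (intros; now rewrite Hp).
reflexivity.
Qed.

(** The kernel splits as [cis (k (t - s)) = cis (k t) * cis (- k s)], and pairing
    with the second factor is the definition of the Fourier coefficient. *)
Lemma fejer_mean_fourier (f : functional) (F : R -> R) (n : nat) (t : R) :
  is_primitive f F ->
  fejer_mean n f t =
  (RtoC (/ (2 * PI)) *
   sum_sym n (fun k : Z =>
     RtoC (1 - IZR (Z.abs k) / (INR n + 1)) * fourier f k * cis (IZR k * t)))%C.
Proof.
intros HF; unfold fejer_mean.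
rewrite (conv_eq_int_mul f F _ _ HF (fejer_C1 n) (fejer_periodic n)).
set (a := fun k s => (RtoC (1 - IZR (Z.abs k) / (INR n + 1)) * cis (IZR k * t) *
                      cis (- (IZR k * s)))%C).
rewrite (int_mul_ext f _ (fun s => RtoC (/ (2 * PI)) * sum_sym n (fun k => a k s))%C).
2: { intros s; unfold fejer; f_equal; apply sum_sym_ext; intros k; unfold a.
     rewrite <- Cmult_assoc, <- cis_plus; do 2 f_equal; ring. }
assert (Ha : forall k, C1_complex (a k)).
{ intros k; apply C1_complex_scal, C1_complex_cis_opp. }
rewrite (int_mul_scal f F) by (trivial; now apply C1_complex_sum_sym).
rewrite (int_mul_sum_sym f F) by trivial.
f_equal; apply sum_sym_ext; intros k.
unfold a; rewrite (int_mul_scal f F) by (trivial; apply C1_complex_cis_opp).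
unfold fourier; ring.
Qed.

Lemma fejer_mean_C1 (f : functional) (F : R -> R) (n : nat) :
  is_primitive f F -> C1_complex (fejer_mean n f).
Proof.
intros HF.
set (a := fun k s => (RtoC (1 - IZR (Z.abs k) / (INR n + 1)) * fourier f k *
                      cis (IZR k * s))%C).
apply (C1_complex_ext (fun t => RtoC (/ (2 * PI)) * sum_sym n (fun k => a k t))%C).
- intros t; now rewrite (fejer_mean_fourier f F n t HF).
- apply C1_complex_scal, C1_complex_sum_sym; intros k.
  apply C1_complex_scal, C1_complex_cis_int.
Qed.

Lemma fejer_mean_im (f : functional) (F : R -> R) (n : nat) (x : R) :
  is_primitive f F -> Im (fejer_mean n f x) = 0.
Proof.
intros HF.
change (int_mul_re (dist_reflect x f) (fun t => Im (fejer n t)) = 0).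
assert (Hk : is_C1 (fejer_re n)) by apply (fejer_C1 n).
rewrite (functional_extensionality (fun t => Im (fejer n t))
           (fun t => 0 * fejer_re n t + 0 * fejer_re n t)).
- rewrite (int_mul_re_lin _ _ _ _ 0 0 (reflect_primitive f F x HF) Hk Hk); ring.
- intros t; rewrite fejer_im; ring.
Qed.

(** * Convergence of the Fejer means *)

Definition fejer_mean_primitive (n : nat) (F : R -> R) (x : R) : R :=
  conv_primitive (fejer_re n) F x - conv_primitive (fejer_re n) F (- PI).

Lemma conv_continuous (F k : R -> R) (x : R) :
  (forall t, continuous F t) -> (forall t, continuous k t) ->
  forall s : R, continuous (fun s : R => F (x - s) * k s) s.
Proof.
intros HF Hk s; apply (continuous_mult (fun s => F (x - s)) k);
  [now apply continuous_reflect|apply Hk].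
Qed.

(** Since the kernel has integral [1], averaging [F] against it preserves the
    increment of [F] over a period. *)
Lemma conv_fejer_translate (F : R -> R) (n : nat) (x : R) (m : Z) :
  Bc F ->
  conv_primitive (fejer_re n) F (x + 2 * IZR m * PI) =
  conv_primitive (fejer_re n) F x + IZR m * F PI.
Proof.
intros HF; unfold conv_primitive.
assert (Ck := fejer_re_continuous n).
rewrite (RInt_eq _ (fun s => 1 * (F (x - s) * fejer_re n s) +
                             (IZR m * F PI) * fejer_re n s)).
- rewrite (RInt_lin _ _ _ _ _ _ (conv_continuous F _ x (proj1 HF) Ck) Ck).
  rewrite RInt_fejer, Rmult_1_l, Rmult_1_r; reflexivity.
- intros s; replace (x + 2 * IZR m * PI - s) with (x - s + 2 * IZR m * PI) by ring.
  rewrite (Bc_translate F _ _ HF); ring.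
Qed.

Lemma fejer_mean_primitive_derive (f : functional) (F : R -> R) (n : nat) (x : R) :
  is_primitive f F ->
  is_derive (fejer_mean_primitive n F) x (Re (fejer_mean n f x)).
Proof.
intros HF.
replace (Re (fejer_mean n f x)) with (minus (Re (fejer_mean n f x)) 0)
  by apply Rminus_0_r.
apply (is_derive_minus (conv_primitive (fejer_re n) F) (fun _ => _)).
- apply (conv_primitive_derive f F (fejer_re n) x HF).
  + apply (fejer_C1 n).
  + intros t; unfold fejer_re; now rewrite fejer_periodic.
- apply (is_derive_const (V := R_NormedModule)).
Qed.

Lemma fejer_mean_is_primitive (f : functional) (F : R -> R) (n : nat) :
  is_primitive f F ->
  is_primitive (dist_of (fejer_mean n f)) (fejer_mean_primitive n F).
Proof.
intros HF; assert (D := fun x => fejer_mean_primitive_derive f F n x HF).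
split; [split; [|split]|].
- intros x; apply (ex_derive_continuous (fejer_mean_primitive n F)).
  eexists; apply D.
- apply Rminus_diag.
- intros y m _; unfold fejer_mean_primitive.
  rewrite (conv_fejer_translate F n y m (proj1 HF)).
  replace (conv_primitive (fejer_re n) F PI)
    with (conv_primitive (fejer_re n) F (- PI) + F PI); [ring|].
  assert (E := conv_fejer_translate F n (- PI) 1 (proj1 HF)).
  rewrite Rmult_1_r, Rmult_1_l in E; rewrite <- E; f_equal; ring.
- intros phi; apply dist_of_derivative; [exact D| |].
  + apply C1_continuous, (fejer_mean_C1 f F n HF).
  + intros x; now apply (fejer_mean_im f F).
Qed.

Lemma fejer_mean_Ac (f : functional) (F : R -> R) (n : nat) :
  is_primitive f F -> Ac (dist_of (fejer_mean n f)).
Proof.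
intros HF; split.
- destruct (fejer_mean_C1 f F n HF) as [H1 H2].
  apply dist_of_distribution; now apply C1_continuous.
- exists (fejer_mean_primitive n F); now apply fejer_mean_is_primitive.
Qed.

(** Near [0] the increment is small by uniform continuity; away from [0] it is
    bounded while [1 - cos s] is bounded below. *)
Lemma Bc_increment (F : R -> R) (eps : posreal) :
  Bc F ->
  exists K, 0 <= K /\ forall x s, - PI <= s <= PI ->
    Rabs (F x - F (x - s)) <= eps + K * (1 - cos s).
Proof.
intros HF; assert (Hpi := PI_RGT_0).
destruct (continuous_Heine F (- 2 * PI) (2 * PI) (proj1 HF) eps) as [d Hd].
destruct (continuous_bounded F (- 2 * PI) (2 * PI) (proj1 HF)) as [B [HB HFB]].
(* [cos] decreases on [[0, PI]], so [1 - cos s >= 1 - cos d'] beyond [d'] *)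
set (d' := Rmin d PI).
assert (Hd' : 0 < d' <= PI).
{ split; [apply Rmin_glb_lt; [apply d|exact Hpi]|apply Rmin_r]. }
assert (Hdd : d' <= d) by apply Rmin_l.
assert (Hc : cos d' < 1) by (rewrite <- cos_0; apply cos_decreasing_1; lra).
set (K := 2 * B / (1 - cos d')).
assert (HK : 0 <= K).
{ apply Rlt_le, Rdiv_lt_0_compat; lra. }
exists K; split; [exact HK|].
assert (He := cond_pos eps).
assert (base : forall y s, - PI <= y < PI -> - PI <= s <= PI ->
          Rabs (F y - F (y - s)) <= eps + K * (1 - cos s)).
{ intros y s Hy Hs.
  destruct (Rlt_le_dec (Rabs s) d') as [Hs'|Hs'].
  - assert (0 <= K * (1 - cos s)).
    { apply Rmult_le_pos; [exact HK|assert (H := COS_bound s); lra]. }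
    assert (Rabs (F y - F (y - s)) < eps); [|lra].
    apply Hd; try lra.
    replace (y - (y - s)) with s by ring; lra.
  - assert (Hcs : cos s <= cos d').
    { assert (Hs2 : Rabs s <= PI) by (apply Rabs_le; lra).
      replace (cos s) with (cos (Rabs s)).
      - apply cos_decr_1; lra.
      - unfold Rabs; destruct (Rcase_abs s); [apply cos_neg|reflexivity]. }
    assert (K * (1 - cos d') <= K * (1 - cos s))
      by (apply Rmult_le_compat_l; lra).
    assert (EK : K * (1 - cos d') = 2 * B) by (unfold K; field; lra).
    assert (H1 := HFB y ltac:(lra)).
    assert (H2 := HFB (y - s) ltac:(lra)).
    assert (H3 := Rabs_triang (F y) (- F (y - s))).
    rewrite Rabs_Ropp in H3; unfold Rminus at 1; lra. }
intros x s Hs; destruct (circle_representative x) as [y [m [Hy ->]]].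
replace (y + 2 * IZR m * PI - s) with (y - s + 2 * IZR m * PI) by ring.
rewrite !(Bc_translate F _ _ HF).
replace (F y + IZR m * F PI - (F (y - s) + IZR m * F PI)) with (F y - F (y - s))
  by ring.
now apply base.
Qed.

(** The difference is the average of [F x - F (x - s)] against the positive kernel;
    inserting the bound of [Bc_increment] leaves the integral and the moment of
    the kernel. *)
Lemma conv_fejer_close (F : R -> R) (eps : posreal) :
  Bc F ->
  exists K, 0 <= K /\ forall n x,
    Rabs (F x - conv_primitive (fejer_re n) F x) <= eps + K * / (INR n + 1).
Proof.
intros HF; destruct (Bc_increment F eps HF) as [K [HK HKs]].
exists K; split; [exact HK|]; intros n x.
assert (Hpi := PI_RGT_0).
assert (Ck := fejer_re_continuous n).
assert (Cc := conv_continuous F _ x (proj1 HF) Ck).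
assert (Cm : forall s : R, continuous (fun s : R => (1 - cos s) * fejer_re n s) s).
{ intros s; apply (continuous_mult (fun s => 1 - cos s)); [|apply Ck].
  apply (continuous_minus (fun _ : R => 1) cos);
    [apply continuous_const|apply continuous_cos]. }
assert (E : F x - conv_primitive (fejer_re n) F x =
  RInt (fun s => (F x - F (x - s)) * fejer_re n s) (- PI) PI).
{ rewrite (RInt_eq _ (fun s => F x * fejer_re n s +
                               (-1) * (F (x - s) * fejer_re n s)))
    by (intros s; ring).
  rewrite (RInt_lin _ _ _ _ _ _ Ck Cc), RInt_fejer; unfold conv_primitive.
  ring. }
assert (E' : eps + K * / (INR n + 1) =
  RInt (fun s => (eps + K * (1 - cos s)) * fejer_re n s) (- PI) PI).
{ rewrite (RInt_eq _ (fun s => eps * fejer_re n s +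
                               K * ((1 - cos s) * fejer_re n s)))
    by (intros s; ring).
  rewrite (RInt_lin _ _ _ _ _ _ Ck Cm), RInt_fejer, RInt_fejer_moment.
  ring. }
rewrite E, E'.
apply (norm_RInt_le (V := R_NormedModule)
  (fun s => (F x - F (x - s)) * fejer_re n s)
  (fun s => (eps + K * (1 - cos s)) * fejer_re n s) (- PI) PI).
- lra.
- intros s Hs.
  change (Rabs ((F x - F (x - s)) * fejer_re n s) <=
          (eps + K * (1 - cos s)) * fejer_re n s).
  rewrite Rabs_mult, (Rabs_right (fejer_re n s)) by apply Rle_ge, fejer_re_pos.
  apply Rmult_le_compat_r; [apply fejer_re_pos|now apply HKs].
- apply (RInt_correct (V := R_CompleteNormedModule)), ex_RInt_cont.
  intros s; apply (continuous_mult (fun s => F x - F (x - s))); [|apply Ck].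
  apply (continuous_minus (fun _ : R => F x) (fun s => F (x - s)));
    [apply continuous_const|apply continuous_reflect, HF].
- apply (RInt_correct (V := R_CompleteNormedModule)), ex_RInt_cont.
  intros s; apply (continuous_mult (fun s => eps + K * (1 - cos s))); [|apply Ck].
  apply (ex_derive_continuous (fun s => eps + K * (1 - cos s))).
  auto_derive; trivial.
Qed.

Lemma fejer_mean_primitive_close (F : R -> R) (eps : posreal) :
  Bc F ->
  eventually (fun n => forall a b,
    Rabs ((F b - fejer_mean_primitive n F b) -
          (F a - fejer_mean_primitive n F a)) <= eps).
Proof.
intros HF; assert (He := cond_pos eps).
assert (H4 : 0 < eps / 4) by lra.
destruct (conv_fejer_close F (mkposreal _ H4) HF) as [K [HK HKn]].
destruct (nfloor_ex (K / (eps / 4))) as [N [_ HN]].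
{ apply Rmult_le_pos; [exact HK|apply Rlt_le, Rinv_0_lt_compat, H4]. }
exists N; intros n Hn a b.
assert (Hsmall : K * / (INR n + 1) <= eps / 4).
{ assert (HNn : INR N <= INR n) by now apply le_INR.
  assert (Hp := pos_INR n).
  apply (Rmult_le_reg_r (INR n + 1)); [lra|].
  rewrite Rmult_assoc, Rinv_l, Rmult_1_r by lra.
  apply (Rmult_le_reg_r (/ (eps / 4))); [now apply Rinv_0_lt_compat|].
  replace (eps / 4 * (INR n + 1) * / (eps / 4)) with (INR n + 1) by (field; lra).
  apply Rlt_le, Rlt_le_trans with (1 := HN); lra. }
assert (Ha := HKn n a); assert (Hb := HKn n b); simpl in Ha, Hb.
unfold fejer_mean_primitive.
replace (F b - (conv_primitive (fejer_re n) F b -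
                conv_primitive (fejer_re n) F (- PI)) -
  (F a - (conv_primitive (fejer_re n) F a -
          conv_primitive (fejer_re n) F (- PI))))
  with ((F b - conv_primitive (fejer_re n) F b) +
        - (F a - conv_primitive (fejer_re n) F a)) by ring.
apply Rle_trans with (1 := Rabs_triang _ _); rewrite Rabs_Ropp; lra.
Qed.

Lemma sub_dist_primitive (f g : functional) (F G : R -> R) :
  is_primitive f F -> is_primitive g G ->
  is_primitive (sub_dist f g) (fun x => F x - G x).
Proof.
intros [[HF [HF0 HFn]] Hf] [[HG [HG0 HGn]] Hg].
split; [split; [|split]|].
- intros x; now apply (continuous_minus F G).
- rewrite HF0, HG0; ring.
- intros y n Hy; rewrite HFn, HGn by exact Hy; ring.
- intros phi; unfold sub_dist; rewrite Hf, Hg; symmetry.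
  now apply dist_derive_minus.
Qed.

Lemma Alexiewicz_le (f : functional) (F : R -> R) (M : R) :
  is_primitive f F -> (forall a b, Rabs (F b - F a) <= M) ->
  Rbar_le (Alexiewicz f) M.
Proof.
intros HF HM; apply Lub_Rbar_correct; intros v [a [b [_ [_ ->]]]].
unfold cpint; rewrite (primitive_eq f F HF); apply HM.
Qed.

Lemma fejer_mean_cvg (f : functional) (F : R -> R) (eps : posreal) :
  is_primitive f F ->
  eventually (fun n =>
    Rbar_lt (Alexiewicz (sub_dist f (dist_of (fejer_mean n f)))) eps).
Proof.
intros HF; assert (He := cond_pos eps).
assert (H2 : 0 < eps / 2) by lra.
apply (filter_imp _ _) with
  (2 := fejer_mean_primitive_close F (mkposreal _ H2) (proj1 HF)).
intros n Hn; apply Rbar_le_lt_trans with (Finite (eps / 2)); [|simpl; lra].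
apply (Alexiewicz_le _ (fun x => F x - fejer_mean_primitive n F x)).
- apply sub_dist_primitive; [exact HF|now apply fejer_mean_is_primitive].
- exact Hn.
Qed.

(** The Fejer means vanish, hence so do their primitives, which converge to the
    primitive of [f] uniformly. *)
Lemma fourier_zero (f : functional) (F : R -> R) :
  is_primitive f F -> (forall n : Z, fourier f n = RtoC 0) ->
  forall phi : test_function, f phi = RtoC 0.
Proof.
intros HF H0.
assert (Hmean : forall n x, fejer_mean n f x = RtoC 0).
{ intros n x; rewrite (fejer_mean_fourier f F n x HF).
  rewrite (sum_sym_ext n _ (fun k => RtoC 0 * RtoC 0)%C).
  - rewrite sum_sym_scal; ring.
  - intros k; rewrite H0; ring. }
assert (HP : forall n x, fejer_mean_primitive n F x = 0).
{ intros n x.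
  assert (E : fejer_mean_primitive n F (- PI) = 0) by apply Rminus_diag.
  rewrite <- E; symmetry.
  assert (D : forall t, is_derive (fejer_mean_primitive n F) t 0).
  { intros t; assert (D := fejer_mean_primitive_derive f F n t HF).
    rewrite Hmean in D; exact D. }
  destruct (MVT_gen (fejer_mean_primitive n F) (- PI) x (fun _ => 0))
    as [c [_ Hc]].
  - intros t _; apply D.
  - intros t _; apply continuity_pt_filterlim.
    apply (ex_derive_continuous (fejer_mean_primitive n F)); eexists; apply D.
  - lra. }
assert (HF0 : F = fun _ => 0).
{ apply functional_extensionality; intros x.
  destruct (Req_dec (F x) 0) as [|Hx]; [assumption|exfalso].
  assert (Hx' : 0 < Rabs (F x) / 2).
  { assert (K := Rabs_pos_lt _ Hx); lra. }
  destruct (fejer_mean_primitive_close F (mkposreal _ Hx') (proj1 HF)) as [N HN].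
  assert (K := HN N (le_n N) (- PI) x); rewrite !HP in K.
  rewrite (proj1 (proj2 (proj1 HF))) in K; simpl in K.
  replace (F x - 0 - (0 - 0)) with (F x) in K by ring; lra. }
intros phi; rewrite (proj2 HF phi), HF0; unfold dist_derive.
rewrite (int_line_compact _ 0 0); [|lra| |].
- rewrite RInt_point; f_equal; apply Ropp_0.
- intros x; apply (continuous_ext (fun _ => 0)); [|apply continuous_const].
  intros t; symmetry; apply Rmult_0_l.
- intros x _; apply Rmult_0_l.
Qed.

Theorem theorem13 :
  Ac_dense (fun g => exists p : R -> C, trig_poly p /\ g = dist_of p) /\
  (forall f : functional, Ac f ->
     (forall (n : nat) (t : R),
        fejer_mean n f t =
        (RtoC (/ (2 * PI)) *
         sum_sym n (fun k : Z =>
           RtoC (1 - IZR (Z.abs k) / (INR n + 1)) *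
           fourier f k * cis (IZR k * t)))%C) /\
     (forall n : nat, Ac (dist_of (fejer_mean n f))) /\
     (forall eps : posreal,
        eventually (fun n : nat =>
          Rbar_lt (Alexiewicz (sub_dist f (dist_of (fejer_mean n f)))) eps)) /\
     ((forall n : Z, fourier f n = RtoC 0) ->
        forall phi : test_function, f phi = RtoC 0)).
Proof.
split.
- intros f [_ [F HF]] eps.
  destruct (fejer_mean_cvg f F eps HF) as [N HN].
  exists (dist_of (fejer_mean N f)); split; [|split].
  + exists (fejer_mean N f); split; [|reflexivity].
    exists N, (fun k => RtoC (/ (2 * PI)) *
      (RtoC (1 - IZR (Z.abs k) / (INR N + 1)) * fourier f k))%C.
    intros t; rewrite (fejer_mean_fourier f F N t HF), <- sum_sym_scal.
    apply sum_sym_ext; intros k; ring.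
  + now apply (fejer_mean_Ac f F).
  + now apply HN.
- intros f [_ [F HF]]; split; [|split; [|split]].
  + intros n t; now apply (fejer_mean_fourier f F).
  + intros n; now apply (fejer_mean_Ac f F).
  + intros eps; now apply (fejer_mean_cvg f F).
  + now apply (fourier_zero f F).
Qed.
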